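(* Let $r \in [0,1)$, $\alpha \in (0,1)$, $\beta \in [0,1]$ and $v \in \mathfrak{U}_{\beta,\alpha}$. Then $$\lim_{n\to\infty} \mathcal{P}_r^n(v) = \Big(\int_{[0,1]} v \,\mathrm{d}\lambda\Big)\cdot h_r$$ uniformly on every compact subset of $[0,1]\setminus \Omega_r(\beta)$, and there is a set $E\subset[0,1]$ of Hausdorff dimension $0$ such that the convergence holds pointwise at every $x \in [0,1]\setminus E$. Moreover, if $\beta$ is pre-periodic with respect to $T_r$ with period length strictly greater than one, then at every point $x$ of the finite set $\Omega_r(\beta)$, $$\liminf_{n\to\infty} \mathcal{P}_r^n(v)(x) = \Big(\int v\,\mathrm{d}\lambda\Big) h_r(x) \quad\text{and}\quad \limsup_{n\to\infty}\mathcal{P}_r^n(v)(x) = +\infty;$$ and if $\beta$ is pre-periodic with respect to $T_r$ with period length equal to one, then at the single point $x$ of $\Omega_r(\beta)$ we have $\lim_{n\to\infty}\mathcal{P}_r^n(v)(x) = +\infty$.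
   Context: For $r\in[0,1]$ define $T_r:[0,1]\to[0,1]$ by $T_r(x) = \frac{(2-r)x}{1-rx}$ for $0\le x\le 1/2$ and $T_r(x)=\frac{(2-r)(1-x)}{1-r+rx}$ for $1/2<x\le 1$. Its inverse branches are $f_{r,0}(x) = \frac{x}{2-r+rx}$ and $f_{r,1}(x) = \frac{1+(1-r)(1-x)}{2-r+rx}$. The Perron–Frobenius operator is $\mathcal{P}_r(f) = f_{r,0}'\cdot f\circ f_{r,0} + |f_{r,1}'|\cdot f\circ f_{r,1}$ (i.e. $\mathcal P_r f(x)=\sum_{y\in T_r^{-1}x} f(y)/|T_r'(y)|$), applied to any function with values in $\mathbb{C}$ or $[0,+\infty]$. $\lambda$ is Lebesgue measure. The invariant density is $h_r = 1$ if $r=0$, $h_r(x) = \frac{-r}{\ln(1-r)}\cdot\frac{1}{1-r+rx}$ if $r\in(0,1)$, and $h_1(x)=1/x$. $\mathrm{BV}(0,1)$ is the set of right-continuous $f:[0,1]\to\mathbb{C}$ with finite total variation $V_{[0,1]}(f)$ and finite $\|f\|_\infty=\sup|f|$. For $\alpha\in(0,1)$, $\beta\in[0,1]$, $\mathfrak{U}_{\beta,\alpha}$ is the set of positive functions $v:[0,1]\to[0,+\infty]$ such that (a) $v(x)\to+\infty$ as $x\to\beta$ from either side (within $[0,1]$); (b) $v\cdot\mathbb{1}_K\in\mathrm{BV}(0,1)$ for every compact $K\subset[0,1]\setminus\{\beta\}$; (c) there are a connected relatively open neighbourhood $U$ of $\beta$ in $[0,1]$ and constants $C_1,C_2>0$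 with $C_1|\beta-x|^{-\alpha}\le v(x)\le C_2|\beta-x|^{-\alpha}$ for $x\in U$. (Such $v$ are improper Riemann integrable.) The $\omega$-limit set is $\Omega_r(\beta)=\bigcap_{k\ge0}\overline{\{T_r^\ell(\beta):\ell\ge k\}}$. A point $x$ is pre-periodic w.r.t. $T_r$ if there are $m\in\mathbb{N}$, $n\in\mathbb{N}_0$ with $T_r^{n+k}(x)=T_r^{n+m+k}(x)$ for all $k\ge0$; the minimal such $m$ is its period length.
   Formalization: Condition (b), which read literally (e.g. K a single point) leaves no admissible v, is taken as: v restricted to K is finite, bounded, of bounded variation and right-continuous relative to K; that Ω_r(β) is finite (a single point for period one) is not restated. *)

(* Defs.v *)
From Stdlib Require Import Reals Lra Lia Rtopology List.
Import ListNotations.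
Open Scope R_scope.

Definition T (r x : R) : R :=
  if Rle_dec x (1/2) then (2 - r) * x / (1 - r * x)
  else (2 - r) * (1 - x) / (1 - r + r * x).

Definition f0 (r x : R) : R := x / (2 - r + r * x).
Definition f1 (r x : R) : R := (1 + (1 - r) * (1 - x)) / (2 - r + r * x).

(* |f_{r,0}'(x)| and |f_{r,1}'(x)|; both equal (2-r)/(2-r+rx)^2 (see the
   lemmas f0_deriv / f1_deriv below). *)
Definition w0 (r x : R) : R := (2 - r) / (2 - r + r * x) ^ 2.
Definition w1 (r x : R) : R := (2 - r) / (2 - r + r * x) ^ 2.

Lemma f0_deriv (r x : R) : 0 <= r < 1 -> 0 <= x <= 1 ->
  derivable_pt_lim (f0 r) x (w0 r x).
Proof.
  intros Hr Hx.
  assert (HD : 2 - r + r * x <> 0) by nra.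
  assert (H1 : derivable_pt_lim (fun y => y) x 1) by apply derivable_pt_lim_id.
  assert (H2 : derivable_pt_lim (fun y => 2 - r + r * y) x (0 + r * 1)).
  { apply derivable_pt_lim_plus. apply derivable_pt_lim_const.
    apply derivable_pt_lim_scal. apply derivable_pt_lim_id. }
  pose proof (derivable_pt_lim_div _ _ x _ _ H1 H2 HD) as H.
  unfold div_fct in H. unfold f0, w0.
  replace ((2 - r) / (2 - r + r * x) ^ 2) with
    ((1 * (2 - r + r * x) - (0 + r * 1) * x) / Rsqr (2 - r + r * x))
    by (unfold Rsqr; field; auto).
  exact H.
Qed.

Lemma f1_deriv (r x : R) : 0 <= r < 1 -> 0 <= x <= 1 ->
  derivable_pt_lim (f1 r) x (- w1 r x).
Proof.
  intros Hr Hx.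
  assert (HD : 2 - r + r * x <> 0) by nra.
  assert (H1 : derivable_pt_lim (fun y => 1 + (1 - r) * (1 - y)) x (0 + (1 - r) * (0 - 1))).
  { apply derivable_pt_lim_plus. apply derivable_pt_lim_const.
    apply derivable_pt_lim_scal. apply derivable_pt_lim_minus.
    apply derivable_pt_lim_const. apply derivable_pt_lim_id. }
  assert (H2 : derivable_pt_lim (fun y => 2 - r + r * y) x (0 + r * 1)).
  { apply derivable_pt_lim_plus. apply derivable_pt_lim_const.
    apply derivable_pt_lim_scal. apply derivable_pt_lim_id. }
  pose proof (derivable_pt_lim_div _ _ x _ _ H1 H2 HD) as H.
  unfold div_fct in H. unfold f1, w1.
  replace (- ((2 - r) / (2 - r + r * x) ^ 2)) with
    (((0 + (1 - r) * (0 - 1)) * (2 - r + r * x) - (0 + r * 1) * (1 + (1 - r) * (1 - x)))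
       / Rsqr (2 - r + r * x)) by (unfold Rsqr; field; auto).
  exact H.
Qed.

Definition h (r x : R) : R :=
  if Req_EM_T r 0 then 1 else (- r / ln (1 - r)) * (1 / (1 - r + r * x)).

Inductive ER : Type := Fin : R -> ER | PInf : ER.

Definition eadd (a b : ER) : ER :=
  match a, b with Fin x, Fin y => Fin (x + y) | _, _ => PInf end.

(* scaling by a real c >= 0, with the convention 0 * (+oo) = 0 *)
Definition escale (c : R) (a : ER) : ER :=
  match a with
  | Fin y => Fin (c * y)
  | PInf => if Req_EM_T c 0 then Fin 0 else PInf
  end.

Definition enonneg (a : ER) : Prop := match a with Fin y => 0 <= y | PInf => True end.
Definition ege (a : ER) (M : R) : Prop := match a with Fin y => M <= y | PInf => True end.
Definition egt (a : ER) (M : R) : Prop := match a with Fin y => M < y | PInf => True end.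
Definition elt (a : ER) (M : R) : Prop := match a with Fin y => y < M | PInf => False end.
Definition ele (a : ER) (M : R) : Prop := match a with Fin y => y <= M | PInf => False end.
Definition eclose (a : ER) (b eps : R) : Prop :=
  match a with Fin y => Rabs (y - b) < eps | PInf => False end.
(* real part (only used where the value is finite) *)
Definition ereal (a : ER) : R := match a with Fin y => y | PInf => 0 end.

Definition PF (r : R) (f : R -> ER) (x : R) : ER :=
  eadd (escale (w0 r x) (f (f0 r x))) (escale (w1 r x) (f (f1 r x))).

Fixpoint PFn (r : R) (n : nat) (f : R -> ER) : R -> ER :=
  match n with O => f | S m => PF r (PFn r m f) end.

Fixpoint strictly_increasing (l : list R) : Prop :=
  match l with
  | x :: ((y :: _) as t) => x < y /\ strictly_increasing t
  | _ => True
  end.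

Fixpoint variation (f : R -> R) (l : list R) : R :=
  match l with
  | x :: ((y :: _) as t) => Rabs (f y - f x) + variation f t
  | _ => 0
  end.

Definition bv_away (beta : R) (v : R -> ER) : Prop :=
  forall K : R -> Prop, compact K ->
    (forall x, K x -> 0 <= x <= 1 /\ x <> beta) ->
    (forall x, K x -> exists y, v x = Fin y) /\
    (exists M, forall x, K x -> Rabs (ereal (v x)) <= M) /\
    (exists V, forall l : list R, strictly_increasing l -> Forall K l ->
        variation (fun x => ereal (v x)) l <= V) /\
    (forall x, K x -> forall eps, eps > 0 -> exists d, d > 0 /\
        forall y, K y -> x <= y < x + d -> Rabs (ereal (v y) - ereal (v x)) < eps).

Definition in_U (beta alpha : R) (v : R -> ER) : Prop :=
  (forall x, 0 <= x <= 1 -> enonneg (v x)) /\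
  (forall M, exists d, d > 0 /\
     forall x, 0 <= x <= 1 -> 0 < Rabs (x - beta) < d -> ege (v x) M) /\
  bv_away beta v /\
  (* (c) two-sided bound C1|beta-x|^-alpha <= v <= C2|beta-x|^-alpha on a
     relatively open connected neighbourhood of beta in [0,1]; such a
     neighbourhood contains [0,1] /\ (beta-d, beta+d) for some d>0 and at x =
     beta the lower bound reads v(beta) = +oo. *)
  (exists d C1 C2, d > 0 /\ C1 > 0 /\ C2 > 0 /\ v beta = PInf /\
     forall x, 0 <= x <= 1 -> 0 < Rabs (x - beta) < d ->
       ege (v x) (C1 * Rpower (Rabs (beta - x)) (- alpha)) /\
       ele (v x) (C2 * Rpower (Rabs (beta - x)) (- alpha))).

Definition improper_integral (v : R -> ER) (beta I : R) : Prop :=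
  forall eta, eta > 0 -> exists d, d > 0 /\ forall eps, 0 < eps < d ->
    exists (pr1 : Riemann_integrable (fun x => ereal (v x)) 0 (Rmax 0 (beta - eps)))
           (pr2 : Riemann_integrable (fun x => ereal (v x)) (Rmin 1 (beta + eps)) 1),
      Rabs (RiemannInt pr1 + RiemannInt pr2 - I) < eta.

Definition omega_limit (r beta : R) (x : R) : Prop :=
  forall k : nat,
    adherence (fun y => exists l : nat, (k <= l)%nat /\ y = Nat.iter l (T r) beta) x.

Definition preperiodic_m (r beta : R) (m : nat) : Prop :=
  (1 <= m)%nat /\ exists n : nat, forall k : nat,
    Nat.iter (n + k) (T r) beta = Nat.iter (n + m + k) (T r) beta.

Definition period_length (r beta : R) (p : nat) : Prop :=
  preperiodic_m r beta p /\ forall m, preperiodic_m r beta m -> (p <= m)%nat.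

Definition hausdorff_null (s : R) (E : R -> Prop) : Prop :=
  forall eps delta, eps > 0 -> delta > 0 ->
    exists a b : nat -> R,
      (forall i, 0 < b i - a i < delta) /\
      (forall x, E x -> exists i, a i <= x <= b i) /\
      (forall n, sum_f_R0 (fun i => Rpower (b i - a i) s) n <= eps).

Definition hausdorff_dim (E : R -> Prop) (d : R) : Prop :=
  (forall s, 0 <= s -> hausdorff_null s E -> d <= s) /\
  (forall t, (forall s, 0 <= s -> hausdorff_null s E -> t <= s) -> t <= d).

(* Main.v *)
Require Import Defs.
From Stdlib Require Import Reals Rtopology Lra Lia List.
From Stdlib Require Import Classical IndefiniteDescription.
From Coquelicot Require Import Coquelicot.
Open Scope R_scope.

(** Conjugated by its invariant density [h], the transfer operator [P] becomes the Markov operator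
    [U g = (1 - p) (g o f0) + p (g o f1)] with [p x = (1 - r + r x) / (2 - r + r x)].  From a
    function whose increments dominate those of [g] one obtains such a majorant for [U g] whose
    total increment is smaller by the factor [1 / (2 - r)].  So [U] contracts the variation; as [P]
    preserves the integral, [P^n f] converges uniformly to [(int f) h] for [f] of bounded variation.

    Up to additive constants, [P] maps [|. - c|^(-a)] below [(2 - r)^(a - 1)] times
    [|. - T c|^(-a)], plus a term that is singular only where both points are close to [1]; the next
    step moves that singularity to the fixed point [0], where it decays at the same rate.  Hence
    [P^n |. - beta|^(-a) (x) <= C (1 + q^n |x - T^n beta|^(-a))] with [q < 1].  For [a] between
    [alpha] and [1], the contribution to [P^n v (x)] of the [d]-neighbourhood of [beta] is at most
    [d^(a - alpha)] times such a bound.  So convergence can fail only at points lying in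
    infinitely many of the balls of radius [rho^n] around [T^n beta], with [rho < 1], a set of
    dimension [0]; and [P^n v (T^n beta) = +oo]. *)

Definition in01 (x : R) : Prop := 0 <= x <= 1.

Lemma ne_of_Rabs_minus_ge x y d : 0 < d -> d <= Rabs (x - y) -> x <> y.
Proof. intros Hd Hfar ->; rewrite Rminus_diag, Rabs_R0 in Hfar; lra. Qed.

Lemma eventually_or_frequently_not (P : nat -> Prop) :
  eventually P \/ forall N, exists n, (N <= n)%nat /\ ~ P n.
Proof.
  destruct (classic (eventually P)) as [|Hno]; [auto | right]. intros N.
  apply NNPP; intros Hall. apply Hno. exists N; intros n Hn.
  apply NNPP; intros HP. apply Hall; exists n; auto.
Qed.

Lemma eventually_geom_lt q C eps : 0 <= q < 1 -> 0 < eps ->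
  eventually (fun n => q ^ n * C < eps).
Proof.
  intros Hq Heps.
  assert (L : is_lim_seq (fun n => q ^ n * C) (0 * C)).
  { apply (is_lim_seq_scal_r (fun n => q ^ n) C 0), is_lim_seq_geom.
    rewrite Rabs_pos_eq; lra. }
  apply is_lim_seq_spec in L. destruct (L (mkposreal eps Heps)) as [N HN].
  exists N; intros n Hn. specialize (HN n Hn). simpl in HN. apply Rabs_def2 in HN; lra.
Qed.

(** * Functions of bounded variation *)

(* [Q x y e] stands for an error of at most [e] over the interval from [x] to [y]; each halving of
   all intervals halves the total error. *)
Lemma dyadic_refinement (Q : R -> R -> R -> Prop) g a b :
  (forall x y, a <= x -> x <= y -> y <= b -> Q x y ((y - x) * (g y - g x))) ->
  (forall x z y d e, x <= z <= y -> Q x z d -> Q z y e -> Q x y (d + e)) ->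
  a <= b -> forall eps, 0 < eps -> exists e, e < eps /\ Q a b e.
Proof.
  intros Hbase Hglue Hab eps Heps.
  assert (Hn : forall n x y, a <= x -> x <= y -> y <= b ->
    Q x y ((/ 2) ^ n * ((y - x) * (g y - g x)))).
  { induction n as [|n IH]; intros x y Hx Hxy Hy.
    - simpl pow; rewrite Rmult_1_l; auto.
    - set (z := (x + y) / 2).
      replace ((/ 2) ^ S n * ((y - x) * (g y - g x)))
        with ((/ 2) ^ n * ((z - x) * (g z - g x)) + (/ 2) ^ n * ((y - z) * (g y - g z)))
        by (unfold z; simpl; field).
      apply Hglue with z; [|apply IH..]; unfold z; lra. }
  destruct (eventually_geom_lt (/ 2) ((b - a) * (g b - g a)) eps) as [N HN]; [lra..|].
  exists ((/ 2) ^ N * ((b - a) * (g b - g a))).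
  split; [apply HN; auto | apply Hn; lra].
Qed.

Lemma eq_of_quadratic_increments Phi g a b : a <= b ->
  (forall x y, a <= x -> x <= y -> y <= b -> Rabs (Phi y - Phi x) <= (y - x) * (g y - g x)) ->
  Phi b = Phi a.
Proof.
  intros Hab Hinc. apply Rminus_diag_uniq, Rabs_eq_0, Rle_antisym; [|apply Rabs_pos].
  apply le_epsilon; intros eps Heps. rewrite Rplus_0_l.
  destruct (dyadic_refinement (fun x y e => Rabs (Phi y - Phi x) <= e) g a b)
    with (eps := eps) as (e & He & Hle); auto; [|lra].
  intros x z y d e _ Hd He.
  replace (Phi y - Phi x) with ((Phi z - Phi x) + (Phi y - Phi z)) by ring.
  eapply Rle_trans; [apply Rabs_triang | lra].
Qed.

Definition var_majorant (a b : R) (f g : R -> R) : Prop :=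
  forall x y, a <= x -> x <= y -> y <= b -> Rabs (f y - f x) <= g y - g x.

Definition bounded_variation (a b : R) (f : R -> R) : Prop :=
  exists g, var_majorant a b f g.

Section Majorants.

Variables (a b : R) (f g : R -> R).
Hypothesis Hfg : var_majorant a b f g.

Lemma var_majorant_mono x y : a <= x -> x <= y -> y <= b -> g x <= g y.
Proof.
  intros Hx Hxy Hy; pose proof (Hfg x y Hx Hxy Hy). pose proof (Rabs_pos (f y - f x)); lra.
Qed.

Lemma var_majorant_sub a' b' : a <= a' -> b' <= b -> var_majorant a' b' f g.
Proof. intros Ha Hb x y Hx Hxy Hy; apply Hfg; lra. Qed.

Lemma var_majorant_ext f' : (forall x, a <= x <= b -> f x = f' x) -> var_majorant a b f' g.
Proof. intros Heq x y Hx Hxy Hy; rewrite <- !Heq by lra; auto. Qed.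

Lemma var_majorant_osc x y : a <= x <= b -> a <= y <= b -> Rabs (f y - f x) <= g b - g a.
Proof.
  intros Hx Hy.
  assert (Hosc : forall s t, a <= s -> s <= t -> t <= b -> Rabs (f t - f s) <= g b - g a).
  { intros s t Hs Hst Ht. pose proof (Hfg s t Hs Hst Ht).
    pose proof (var_majorant_mono a s). pose proof (var_majorant_mono t b). lra. }
  destruct (Rle_dec x y); [|rewrite Rabs_minus_sym]; apply Hosc; lra.
Qed.

Lemma var_majorant_bounded : exists M, forall x, a <= x <= b -> Rabs (f x) <= M.
Proof.
  exists (Rabs (f a) + (g b - g a)). intros x Hx.
  replace (f x) with (f a + (f x - f a)) by ring.
  eapply Rle_trans; [apply Rabs_triang|]. apply Rplus_le_compat_l, var_majorant_osc; lra.
Qed.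

End Majorants.

Lemma bounded_variation_mult a b f k :
  bounded_variation a b f -> bounded_variation a b k -> bounded_variation a b (fun x => f x * k x).
Proof.
  intros [gf Hf] [gk Hk].
  destruct (var_majorant_bounded a b f gf Hf) as [M HM].
  destruct (var_majorant_bounded a b k gk Hk) as [N HN].
  exists (fun x => N * gf x + M * gk x). intros x y Hx Hxy Hy.
  replace (f y * k y - f x * k x) with (k y * (f y - f x) + f x * (k y - k x)) by ring.
  eapply Rle_trans; [apply Rabs_triang|]. rewrite !Rabs_mult.
  apply Rle_trans with (N * (gf y - gf x) + M * (gk y - gk x)); [|right; ring].
  apply Rplus_le_compat; apply Rmult_le_compat; auto using Rabs_pos; [apply HN | apply HM]; lra.
Qed.

Lemma IsStepFun_ext f g a b : a <= b -> (forall x, a < x < b -> f x = g x) ->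
  IsStepFun f a b -> IsStepFun g a b.
Proof.
  intros Hab Heq (l & lf & Hord & Hfirst & Hlast & Hlen & Hcst). exists l, lf.
  repeat split; auto. intros i Hi x Hx. rewrite <- (Hcst i Hi x Hx). symmetry; apply Heq.
  rewrite Rmin_left in Hfirst by auto. rewrite Rmax_right in Hlast by auto.
  destruct (RList.RList_P6 l) as [Hmono _]. specialize (Hmono Hord).
  pose proof (Hmono 0%nat i ltac:(lia) ltac:(lia)).
  pose proof (Hmono (S i) (Nat.pred (length l)) ltac:(lia) ltac:(lia)).
  unfold open_interval in Hx. lra.
Qed.

Definition step_approx (f : R -> R) (a b e : R) : Prop :=
  exists phi psi : StepFun a b,
    (forall t, a <= t <= b -> Rabs (f t - phi t) <= psi t) /\ RiemannInt_SF psi <= e.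

Lemma step_approx_glue f a c b d e : a <= c <= b ->
  step_approx f a c d -> step_approx f c b e -> step_approx f a b (d + e).
Proof.
  intros Hc (phi1 & psi1 & Hphi1 & Hpsi1) (phi2 & psi2 & Hphi2 & Hpsi2).
  set (glue := fun (u v : R -> R) x => if Rle_dec x c then u x else v x).
  assert (Hleft : forall u v, IsStepFun u a c -> IsStepFun (glue u v) a c).
  { intros u v; apply IsStepFun_ext; [lra|].
    intros x Hx; unfold glue; destruct (Rle_dec x c); lra. }
  assert (Hright : forall u v, IsStepFun v c b -> IsStepFun (glue u v) c b).
  { intros u v; apply IsStepFun_ext; [lra|].
    intros x Hx; unfold glue; destruct (Rle_dec x c); lra. }
  pose (psil := Hleft psi1 psi2 (pre psi1)). pose (psir := Hright psi1 psi2 (pre psi2)).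
  exists (mkStepFun (StepFun_P46 (Hleft phi1 phi2 (pre phi1)) (Hright phi1 phi2 (pre phi2)))),
    (mkStepFun (StepFun_P46 psil psir)). split.
  - intros t Ht; simpl; unfold glue; destruct (Rle_dec t c); [apply Hphi1|apply Hphi2]; lra.
  - rewrite <- (StepFun_P43 psil psir). apply Rplus_le_compat.
    + eapply Rle_trans; [|apply Hpsi1]. apply StepFun_P37; [lra|].
      intros x Hx; simpl; unfold glue; destruct (Rle_dec x c); lra.
    + eapply Rle_trans; [|apply Hpsi2]. apply StepFun_P37; [lra|].
      intros x Hx; simpl; unfold glue; destruct (Rle_dec x c); lra.
Qed.

Lemma var_majorant_step_approx f g a b : a <= b -> var_majorant a b f g ->
  forall eps, 0 < eps -> exists e, e < eps /\ step_approx f a b e.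
Proof.
  intros Hab Hfg. apply dyadic_refinement with g; auto; [|intros; eapply step_approx_glue; eauto].
  intros x y Hx Hxy Hy.
  exists (mkStepFun (StepFun_P4 x y (f x))), (mkStepFun (StepFun_P4 x y (g y - g x))).
  split; [|rewrite StepFun_P18; simpl; lra].
  intros t Ht; simpl; unfold fct_cte.
  apply (var_majorant_osc x y); [apply (var_majorant_sub a b) | |]; auto; lra.
Qed.

Lemma ex_RInt_bounded_variation f a b : a <= b -> bounded_variation a b f -> ex_RInt f a b.
Proof.
  intros Hab [g Hfg]. apply ex_RInt_Reals_1. intros eps.
  destruct (constructive_indefinite_description _
    (var_majorant_step_approx f g a b Hab Hfg eps (cond_pos eps))) as (e & He & Happrox).
  destruct (constructive_indefinite_description _ Happrox) as [phi Hphi].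
  destruct (constructive_indefinite_description _ Hphi) as (psi & Hpsi & Hint).
  exists phi, psi. rewrite Rmin_left, Rmax_right by auto. split; auto.
  rewrite Rabs_pos_eq; [lra|].
  rewrite <- (Rmult_0_l (b - a)), <- StepFun_P18. apply StepFun_P37; auto.
  intros x Hx; simpl; unfold fct_cte. eapply Rle_trans; [apply Rabs_pos|apply (Hpsi x); lra].
Qed.

Lemma ex_RInt_subinterval (f : R -> R) a b c d :
  a <= c -> c <= d -> d <= b -> ex_RInt f a b -> ex_RInt f c d.
Proof.
  intros Hac Hcd Hdb Hf. apply (ex_RInt_Chasles_2 f a c d); [lra|].
  apply (ex_RInt_Chasles_1 f a d b); [lra | auto].
Qed.

Lemma RInt_Chasles_minus (f : R -> R) a x y :
  ex_RInt f a x -> ex_RInt f x y -> RInt f a y - RInt f a x = RInt f x y.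
Proof.
  intros Hax Hxy. rewrite <- (RInt_Chasles f a x y Hax Hxy). unfold plus; simpl; ring.
Qed.

Lemma RInt_dist_const f a b z e : a <= b -> ex_RInt f a b ->
  (forall t, a <= t <= b -> Rabs (f t - z) <= e) -> Rabs (RInt f a b - (b - a) * z) <= (b - a) * e.
Proof.
  intros Hab Hf Hosc.
  replace (RInt f a b - (b - a) * z) with (RInt (fun t => f t - z) a b).
  - apply abs_RInt_le_const; auto. apply (ex_RInt_minus f (fun _ => z)); auto. apply ex_RInt_const.
  - rewrite (RInt_minus (V := R_CompleteNormedModule) f (fun _ => z))
      by (auto; apply ex_RInt_const).
    rewrite RInt_const. reflexivity.
Qed.

Lemma var_majorant_RInt_approx f g a b z : var_majorant a b f g -> a <= z <= b ->
  Rabs (RInt f a b - (b - a) * f z) <= (b - a) * (g b - g a).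
Proof.
  intros Hfg Hz. apply RInt_dist_const; [lra| |].
  - apply ex_RInt_bounded_variation; [lra | exists g; auto].
  - intros t Ht; apply (var_majorant_osc a b); auto.
Qed.

(* Error of the substitution rule over a short interval: [w] approximates the derivative of the
   change of variables, [dx] is the length of the source interval. *)
Lemma RInt_substitution_error f g a b p q z w dx M : var_majorant a b f g ->
  a <= p -> p <= z <= q -> q <= b -> q - p <= dx -> Rabs (q - p - w * dx) <= dx ^ 2 ->
  Rabs (f z) <= M ->
  Rabs (RInt f p q - dx * (w * f z)) <= dx * (g q - g p + M * dx).
Proof.
  intros Hfg Hp Hz Hq Hlen Hderiv HM.
  pose proof (var_majorant_RInt_approx f g p q z (var_majorant_sub a b f g Hfg p q Hp Hq) Hz).
  pose proof (var_majorant_mono a b f g Hfg p q ltac:(lra) ltac:(lra) ltac:(lra)).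
  replace (RInt f p q - dx * (w * f z))
    with ((RInt f p q - (q - p) * f z) + (q - p - w * dx) * f z) by ring.
  eapply Rle_trans; [apply Rabs_triang|]. rewrite Rabs_mult.
  apply Rle_trans with ((q - p) * (g q - g p) + dx ^ 2 * M).
  - apply Rplus_le_compat; auto. apply Rmult_le_compat; auto using Rabs_pos.
  - apply Rle_trans with (dx * (g q - g p) + dx ^ 2 * M); [|right; ring].
    apply Rplus_le_compat_r, Rmult_le_compat_r; lra.
Qed.

Lemma variation_cons (K : R -> Prop) F x y l : K x -> K y -> x < y ->
  strictly_increasing l -> List.Forall (fun z => K z /\ y <= z) l ->
  exists l', strictly_increasing l' /\ List.Forall (fun z => K z /\ x <= z) l' /\
    Rabs (F y - F x) + variation F l <= variation F l'.
Proof.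
  intros Kx Ky Hxy Hinc HF.
  assert (HF' : List.Forall (fun z => K z /\ x <= z) l).
  { eapply List.Forall_impl; [|apply HF]. simpl; intros z [Kz Hz]; split; auto; lra. }
  destruct l as [|z l].
  - exists (x :: y :: nil). simpl; repeat split; auto; [|lra].
    repeat constructor; auto; lra.
  - inversion HF as [|? ? [Kz Hyz] _]; subst. destruct (Req_dec z y) as [->|Hne].
    + exists (x :: y :: l). split; [split; auto|]. split; [constructor; auto; split; auto; lra|].
      apply Rle_refl.
    + exists (x :: y :: z :: l). split; [repeat split; auto; lra|].
      split; [constructor; [|constructor]; auto; split; auto; lra|].
      change (Rabs (F y - F x) + variation F (z :: l)
        <= Rabs (F y - F x) + (Rabs (F z - F y) + variation F (z :: l))).
      pose proof (Rabs_pos (F z - F y)); lra.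
Qed.

(* The majorant is minus the supremum of the variations over subdivisions of [K] to the right
   of the point. *)
Lemma var_majorant_of_variation (K : R -> Prop) F M :
  (forall l, strictly_increasing l -> List.Forall K l -> variation F l <= M) ->
  exists V : R -> R, (forall x y, x <= y -> V x <= V y) /\
    (forall x y, K x -> K y -> x <= y -> Rabs (F y - F x) <= V y - V x).
Proof.
  intros HM.
  set (E := fun x u => exists l, strictly_increasing l /\
    List.Forall (fun z => K z /\ x <= z) l /\ u = variation F l).
  assert (Hbound : forall x, bound (E x)).
  { intros x; exists M; intros u (l & Hinc & HF & ->). apply HM; auto.
    eapply List.Forall_impl; [|apply HF]. simpl; tauto. }
  assert (Hne : forall x, exists u, E x u) by (intros x; exists 0, nil; simpl; auto).
  set (V := fun x => proj1_sig (completeness (E x) (Hbound x) (Hne x))).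
  assert (HV : forall x, is_lub (E x) (V x)) by (intros x; unfold V; apply proj2_sig).
  exists (fun x => - V x); split.
  - intros x y Hxy. apply Ropp_le_contravar, (HV y). intros u (l & Hinc & HF & ->).
    apply (HV x). exists l; repeat split; auto.
    eapply List.Forall_impl; [|apply HF]. intros z [Kz Hz]; split; auto; lra.
  - intros x y Kx Ky Hxy. destruct (Req_dec x y) as [->|Hxy'].
    { rewrite !Rminus_diag, Rabs_R0; lra. }
    assert (V y <= V x - Rabs (F y - F x)); [|lra].
    apply (HV y). intros u (l & Hinc & HF & ->).
    destruct (variation_cons K F x y l) as (l' & Hinc' & HF' & Hvar); auto; [lra|].
    assert (variation F l' <= V x); [|lra]. apply (HV x). exists l'; auto.
Qed.

Definition cutoff (F : R -> R) (b d y : R) : R := if Rlt_dec (Rabs (y - b)) d then 0 else F y.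

Lemma cutoff_inside F b d y : b - d < y < b + d -> cutoff F b d y = 0.
Proof.
  intros Hy; unfold cutoff; destruct (Rlt_dec _ _) as [|Hfar]; auto.
  destruct Hfar; apply Rabs_def1; lra.
Qed.

Lemma cutoff_outside F b d y : y <= b - d \/ b + d <= y -> cutoff F b d y = F y.
Proof.
  intros Hy; unfold cutoff; destruct (Rlt_dec _ _) as [Hnear|]; auto.
  apply Rabs_def2 in Hnear; lra.
Qed.

Lemma cutoff_bounds F b d y : 0 <= F y -> 0 <= cutoff F b d y <= F y.
Proof. intros Hy; unfold cutoff; destruct (Rlt_dec _ _); lra. Qed.

Lemma cutoff_antitone F b d d' y : d <= d' -> 0 <= F y -> cutoff F b d' y <= cutoff F b d y.
Proof. intros Hd Hy; unfold cutoff; destruct (Rlt_dec _ d'), (Rlt_dec _ d); lra. Qed.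

Definition away (lo hi b d x : R) : Prop := lo <= x <= hi /\ d <= Rabs (x - b).

Lemma away_ne lo hi b d x : 0 < d -> away lo hi b d x -> lo <= x <= hi /\ x <> b.
Proof. intros Hd [Hx Hfar]; split; auto. apply ne_of_Rabs_minus_ge with d; auto. Qed.

Lemma compact_away lo hi b d : 0 < d -> compact (away lo hi b d).
Proof.
  intros Hd.
  apply compact_P4 with (fun c => lo <= c <= hi); [apply compact_P3 | | intros x [Hx _]; auto].
  intros x Hx. destruct (classic (lo <= x <= hi)) as [Hin|Hout].
  - apply neighbourhood_P1 with (disc b (mkposreal d Hd)).
    + unfold disc; simpl; intros y Hy [_ Hfar]; lra.
    + apply disc_P1. apply Rnot_le_lt; intros Hfar; apply Hx; split; auto.
  - apply neighbourhood_P1 with (complementary (fun c => lo <= c <= hi)).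
    + intros y Hy [Hin _]; auto.
    + apply (compact_P2 _ (compact_P3 lo hi)); auto.
Qed.

(* The two jumps of the cutoff, at [b - d] and [b + d], are each at most [M]. *)
Lemma bounded_variation_cutoff lo hi F V b d M : 0 < d ->
  (forall x y, x <= y -> V x <= V y) ->
  (forall x, away lo hi b d x -> Rabs (F x) <= M) ->
  (forall x y, away lo hi b d x -> away lo hi b d y -> x <= y -> Rabs (F y - F x) <= V y - V x) ->
  bounded_variation lo hi (cutoff F b d).
Proof.
  intros Hd Vmono HM HV.
  exists (fun y => V y + Rabs M * (if Rlt_dec (b - d) y then 1 else 0)
                       + Rabs M * (if Rlt_dec y (b + d) then 0 else 1)).
  intros x y Hx Hxy Hy. pose proof (Vmono x y Hxy). pose proof (Rle_abs M). pose proof (Rabs_pos M).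
  assert (Hcase : forall z, lo <= z <= hi -> b - d < z < b + d /\ cutoff F b d z = 0 \/
    (z <= b - d \/ b + d <= z) /\ away lo hi b d z /\ cutoff F b d z = F z).
  { intros z Hz. unfold cutoff; destruct (Rlt_dec (Rabs (z - b)) d) as [Hnear|Hfar].
    - left; apply Rabs_def2 in Hnear; lra.
    - apply Rnot_lt_le in Hfar. right; split; [|split; [split|]; auto].
      unfold Rabs in Hfar; destruct (Rcase_abs _); lra. }
  destruct (Hcase x) as [(Ix & ->)|(Ox & Kx & ->)]; [lra | |];
  destruct (Hcase y) as [(Iy & ->)|(Oy & Ky & ->)]; try lra;
    [rewrite Rminus_diag, Rabs_R0 | rewrite Rminus_0_r; pose proof (HM y Ky)
      | rewrite Rminus_0_l, Rabs_Ropp; pose proof (HM x Kx) | pose proof (HV x y Kx Ky Hxy)];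
    destruct (Rlt_dec (b - d) x), (Rlt_dec (b - d) y), (Rlt_dec x (b + d)), (Rlt_dec y (b + d));
    lra.
Qed.

Lemma RInt_cutoff_split lo hi F b d : 0 < d -> lo <= b <= hi -> ex_RInt (cutoff F b d) lo hi ->
  ex_RInt F lo (Rmax lo (b - d)) /\ ex_RInt F (Rmin hi (b + d)) hi /\
  RInt F lo (Rmax lo (b - d)) + RInt F (Rmin hi (b + d)) hi = RInt (cutoff F b d) lo hi.
Proof.
  intros Hd Hb Hint. set (p := Rmax lo (b - d)). set (q := Rmin hi (b + d)).
  assert (Hp : lo <= p <= b /\ b - d <= p /\ (p = lo \/ p = b - d)).
  { unfold p, Rmax; destruct (Rle_dec _ _); lra. }
  assert (Hq : b <= q <= hi /\ q <= b + d /\ (q = hi \/ q = b + d)).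
  { unfold q, Rmin; destruct (Rle_dec _ _); lra. }
  assert (Isub : forall c e, lo <= c -> c <= e -> e <= hi -> ex_RInt (cutoff F b d) c e).
  { intros c e Hc Hce He; apply (ex_RInt_subinterval _ lo hi); auto. }
  assert (Eleft : forall x, Rmin lo p < x < Rmax lo p -> cutoff F b d x = F x).
  { rewrite Rmin_left, Rmax_right by lra. intros x Hx; apply cutoff_outside; lra. }
  assert (Emid : forall x, Rmin p q < x < Rmax p q -> cutoff F b d x = 0).
  { rewrite Rmin_left, Rmax_right by lra. intros x Hx; apply cutoff_inside; lra. }
  assert (Eright : forall x, Rmin q hi < x < Rmax q hi -> cutoff F b d x = F x).
  { rewrite Rmin_left, Rmax_right by lra. intros x Hx; apply cutoff_outside; lra. }
  split; [|split].
  - apply (ex_RInt_ext _ _ _ _ Eleft), Isub; lra.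
  - apply (ex_RInt_ext _ _ _ _ Eright), Isub; lra.
  - rewrite <- (RInt_ext _ _ _ _ Eleft), <- (RInt_ext _ _ _ _ Eright).
    rewrite <- (RInt_Chasles (cutoff F b d) lo p hi), <- (RInt_Chasles (cutoff F b d) p q hi)
      by (apply Isub; lra).
    rewrite (RInt_ext _ _ _ _ Emid), RInt_const.
    unfold plus, scal; simpl; unfold mult; simpl; ring.
Qed.

(** * Real powers *)

Lemma Rpower_opp_le a x y : 0 <= a -> 0 < x <= y -> Rpower y (- a) <= Rpower x (- a).
Proof.
  intros Ha Hxy; rewrite !Rpower_Ropp.
  apply Rinv_le_contravar; [apply exp_pos | apply Rle_Rpower_l; auto].
Qed.

Lemma ln_neg x : 0 < x < 1 -> ln x < 0.
Proof. intros Hx; rewrite <- ln_1; apply ln_increasing; lra. Qed.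

Lemma Rpower_lt_1 x e : 0 < x < 1 -> 0 < e -> Rpower x e < 1.
Proof.
  intros Hx He. rewrite <- exp_0. apply exp_increasing. pose proof (ln_neg x Hx). nra.
Qed.

Lemma Rpower_1_base e : Rpower 1 e = 1.
Proof. unfold Rpower; rewrite ln_1, Rmult_0_r, exp_0; reflexivity. Qed.

Lemma Rpower_eventually_le e eta : 0 < e -> 0 < eta ->
  exists d, 0 < d /\ forall x, 0 < x <= d -> Rpower x e <= eta.
Proof.
  intros He Heta. exists (Rpower eta (/ e)). split; [apply exp_pos|].
  intros x Hx. replace eta with (Rpower (Rpower eta (/ e)) e).
  - apply Rle_Rpower_l; lra.
  - rewrite Rpower_mult, Rinv_l, Rpower_1; lra.
Qed.

Lemma Rpower_1_plus_le a x : 0 <= a <= 1 -> 0 < x -> Rpower (1 + x) a <= 1 + Rpower x a.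
Proof.
  intros Ha Hx.
  assert (E : forall z, 0 < z -> Rpower z a = Rpower z (- (1 - a)) * z).
  { intros z Hz. rewrite <- (Rpower_1 z) at 3 by auto. rewrite <- Rpower_plus. f_equal; ring. }
  rewrite !E by lra.
  pose proof (Rpower_opp_le (1 - a) x (1 + x) ltac:(lra) ltac:(lra)).
  pose proof (Rpower_opp_le (1 - a) 1 (1 + x) ltac:(lra) ltac:(lra)) as Hle1.
  rewrite Rpower_1_base in Hle1. nra.
Qed.

(* One weight [w] is lost to the distance [y] contracted by [w]; the distortion [1 / (1 + u)] only
   costs an additive constant because [t ^ a] is subadditive. *)
Lemma weighted_Rpower_le a k w u y : 0 <= a <= 1 -> 0 < w <= k -> 0 < u -> w * (u / (1 + u)) <= y ->
  w * Rpower y (- a) <= Rpower k (1 - a) * (1 + Rpower u (- a)).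
Proof.
  intros Ha Hw Hu Hy.
  assert (Hu1 : 0 < u / (1 + u)) by (apply Rdiv_lt_0_compat; lra).
  apply Rle_trans with (w * Rpower (w * (u / (1 + u))) (- a)).
  { apply Rmult_le_compat_l; [lra|]. apply Rpower_opp_le; [lra|]. split; [nra | auto]. }
  rewrite <- Rpower_mult_distr, <- Rmult_assoc by lra.
  apply Rmult_le_compat; try (left; apply exp_pos).
  - apply Rmult_le_pos; [lra | left; apply exp_pos].
  - apply Rle_trans with (Rpower w (1 - a)); [|apply Rle_Rpower_l; lra].
    unfold Rminus. rewrite Rpower_plus, Rpower_1 by lra. apply Rle_refl.
  - assert (Einv : forall z, 0 < z -> Rpower z (- a) = Rpower (/ z) a).
    { intros z Hz. unfold Rpower. f_equal. rewrite ln_Rinv by auto. ring. }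
    rewrite !Einv by auto. replace (/ (u / (1 + u))) with (1 + / u) by (field; lra).
    apply Rpower_1_plus_le; auto using Rinv_0_lt_compat.
Qed.

(** * Limit points and Hausdorff dimension *)

Lemma ValAdh_dist (u : nat -> R) x :
  ValAdh u x <-> forall eps N, 0 < eps -> exists n, (N <= n)%nat /\ Rabs (u n - x) < eps.
Proof.
  split.
  - intros Hx eps N Heps. apply (Hx (disc x (mkposreal eps Heps)) N).
    exists (mkposreal eps Heps); intros y Hy; auto.
  - intros Hx V N [[eps Heps] HV]. destruct (Hx eps N Heps) as (n & Hn & Hdist). exists n; auto.
Qed.

Lemma compact_eventually_away (u : nat -> R) (K : R -> Prop) : compact K ->
  (forall x, K x -> ~ ValAdh u x) ->
  exists c, 0 < c /\ eventually (fun n => forall x, K x -> c <= Rabs (x - u n)).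
Proof.
  intros HK Hnot. apply NNPP; intros Hno.
  assert (Hclose : forall N : nat, exists p : nat * R,
    (N <= fst p)%nat /\ K (snd p) /\ Rabs (snd p - u (fst p)) < / INR (S N)).
  { intros N. apply NNPP; intros Hfar. apply Hno. exists (/ INR (S N)).
    split; [apply Rinv_0_lt_compat, lt_0_INR; lia|].
    exists N. intros n Hn x Kx. apply Rnot_lt_le; intros Hlt. apply Hfar. exists (n, x); auto. }
  destruct (functional_choice _ Hclose) as [p Hp].
  destruct (Bolzano_Weierstrass (fun N => snd (p N)) K HK) as [l Hl]; [intros N; apply Hp|].
  apply (Hnot l).
  - apply (adherence_P2 K (compact_P2 K HK)). intros V HV.
    destruct (Hl V 0%nat HV) as (N & _ & HN). exists (snd (p N)). split; [auto | apply Hp].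
  - apply ValAdh_dist; intros eps N Heps.
    destruct (archimed_cor1 (eps / 2)) as (m & Hm & Hm0); [lra|].
    destruct (proj1 (ValAdh_dist _ _) Hl (eps / 2) (N + m)%nat) as (k & Hk & Hdist); [lra|].
    destruct (Hp k) as (Hn & _ & Hpk). exists (fst (p k)). split; [lia|].
    assert (/ INR (S k) <= / INR m).
    { apply Rinv_le_contravar; [apply lt_0_INR; lia | apply le_INR; lia]. }
    replace (u (fst (p k)) - l) with (- (snd (p k) - u (fst (p k))) + (snd (p k) - l)) by ring.
    eapply Rle_lt_trans; [apply Rabs_triang|]. rewrite Rabs_Ropp. lra.
Qed.

Lemma list_separated x l : exists d, 0 < d /\ forall z, In z l -> z = x \/ d <= Rabs (z - x).
Proof.
  induction l as [|y l (d & Hd & IH)]; [exists 1; split; [lra | intros z []]|].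
  destruct (Req_dec y x) as [->|Hne].
  - exists d; split; auto. intros z [->|Hz]; auto.
  - exists (Rmin d (Rabs (y - x))). split; [apply Rmin_pos; auto; apply Rabs_pos_lt; lra|].
    intros z [->|Hz]; [right; apply Rmin_r|].
    destruct (IH z Hz) as [|Hle]; [auto | right; eapply Rle_trans; [apply Rmin_l | auto]].
Qed.

Lemma ValAdh_finite_range (u : nat -> R) x l : ValAdh u x -> eventually (fun n => In (u n) l) ->
  forall N, exists n, (N <= n)%nat /\ u n = x.
Proof.
  intros Hx [N0 Hl] N. destruct (list_separated x l) as (d & Hd & Hsep).
  destruct (proj1 (ValAdh_dist u x) Hx d (N + N0)%nat Hd) as (n & Hn & Hdist).
  exists n; split; [lia|].
  destruct (Hsep (u n)) as [E|Hle]; [apply Hl; lia | auto | lra].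
Qed.

Lemma sum_geom_le q n : 0 <= q < 1 -> sum_f_R0 (fun i => q ^ i) n <= / (1 - q).
Proof.
  intros Hq; rewrite tech3 by lra. pose proof (pow_le q (S n) ltac:(lra)).
  rewrite <- (Rmult_1_l (/ (1 - q))). apply Rmult_le_compat_r; [|lra].
  left; apply Rinv_0_lt_compat; lra.
Qed.

Lemma Rpower_pow_swap x s n : 0 < x -> Rpower (x ^ n) s = Rpower x s ^ n.
Proof.
  intros Hx. rewrite <- !Rpower_pow by (auto; apply exp_pos). rewrite !Rpower_mult. f_equal; ring.
Qed.

Lemma hausdorff_null_limsup_balls (y : nat -> R) rho s (E : R -> Prop) : 0 < rho < 1 -> 0 < s ->
  (forall x, E x -> forall N : nat, exists n, (N <= n)%nat /\ Rabs (x - y n) < rho ^ n) ->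
  hausdorff_null s E.
Proof.
  intros Hrho Hs HE eps delta Heps Hdelta.
  set (q := Rpower rho s).
  assert (Hq : 0 < q < 1) by (split; [apply exp_pos | apply Rpower_lt_1; auto]).
  destruct (eventually_geom_lt rho 2 delta ltac:(lra) Hdelta) as [N1 HN1].
  destruct (eventually_geom_lt q (Rpower 2 s * / (1 - q)) eps ltac:(lra) Heps) as [N2 HN2].
  set (N := (N1 + N2)%nat).
  exists (fun i => y (N + i)%nat - rho ^ (N + i)), (fun i => y (N + i)%nat + rho ^ (N + i)).
  split; [|split].
  - intros i. specialize (HN1 (N + i)%nat ltac:(lia)).
    pose proof (pow_lt rho (N + i) ltac:(lra)). lra.
  - intros x Hx. destruct (HE x Hx N) as (n & Hn & Hxn). exists (n - N)%nat.
    replace (N + (n - N))%nat with n by lia. apply Rabs_def2 in Hxn; lra.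
  - intros n.
    rewrite (sum_eq _ (fun i => q ^ i * (q ^ N * Rpower 2 s))).
    2:{ intros i _. pose proof (pow_lt rho (N + i) ltac:(lra)).
        replace (y (N + i)%nat + rho ^ (N + i) - (y (N + i)%nat - rho ^ (N + i)))
          with (rho ^ (N + i) * 2) by ring.
        rewrite <- Rpower_mult_distr, Rpower_pow_swap, pow_add by lra. fold q; ring. }
    rewrite <- scal_sum. specialize (HN2 N ltac:(lia)).
    apply Rle_trans with (q ^ N * Rpower 2 s * / (1 - q)); [|lra].
    apply Rmult_le_compat_l; [|apply sum_geom_le; lra].
    apply Rmult_le_pos; [apply pow_le; lra | left; apply exp_pos].
Qed.

Lemma hausdorff_dim_0 (E : R -> Prop) :
  (forall s, 0 < s -> hausdorff_null s E) -> hausdorff_dim E 0.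
Proof.
  intros HE; split; [auto|]. intros t Ht. apply le_epsilon; intros s Hs.
  rewrite Rplus_0_l; apply Ht; [lra | auto].
Qed.

(** * The interval map and its transfer operator *)

Section TransferOperator.

Variable r : R.
Hypothesis Hr : 0 <= r < 1.

Lemma branch_den_bounds x : in01 x -> 1 < 2 - r + r * x <= 2 /\ 2 - r <= 2 - r + r * x.
Proof. unfold in01; intros; nra. Qed.

Lemma f1_reflect x : in01 x -> f1 r x = 1 - f0 r x.
Proof. intros Hx; pose proof (branch_den_bounds x Hx). unfold f0, f1; field; lra. Qed.

Lemma f0_sub x y : in01 x -> in01 y ->
  f0 r y - f0 r x = (2 - r) * (y - x) / ((2 - r + r * x) * (2 - r + r * y)).
Proof.
  intros Hx Hy; pose proof (branch_den_bounds x Hx); pose proof (branch_den_bounds y Hy).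
  unfold f0; field; lra.
Qed.

Lemma f0_0 : f0 r 0 = 0.
Proof. unfold f0; field; lra. Qed.

Lemma f0_1 : f0 r 1 = 1 / 2.
Proof. unfold f0; field; lra. Qed.

Lemma f0_increasing x y : in01 x -> in01 y -> x <= y -> f0 r x <= f0 r y.
Proof.
  intros Hx Hy Hxy; pose proof (branch_den_bounds x Hx); pose proof (branch_den_bounds y Hy).
  apply Rminus_le_0. rewrite f0_sub by auto. apply Rdiv_le_0_compat; nra.
Qed.

Lemma f0_nonexpansive x y : in01 x -> in01 y -> x <= y -> f0 r y - f0 r x <= y - x.
Proof.
  intros Hx Hy Hxy; pose proof (branch_den_bounds x Hx); pose proof (branch_den_bounds y Hy).
  rewrite f0_sub by auto. apply <- Rle_div_l; [|nra].
  rewrite Rmult_comm. apply Rmult_le_compat_l; nra.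
Qed.

Lemma f0_range x : in01 x -> 0 <= f0 r x <= 1 / 2.
Proof.
  intros Hx; rewrite <- f0_1, <- f0_0 at 1.
  split; apply f0_increasing; auto; unfold in01 in *; lra.
Qed.

Lemma f0_in01 x : in01 x -> in01 (f0 r x).
Proof. intros Hx; pose proof (f0_range x Hx); unfold in01; lra. Qed.

Lemma f1_range x : in01 x -> 1 / 2 <= f1 r x <= 1.
Proof. intros Hx; rewrite f1_reflect by auto; pose proof (f0_range x Hx); lra. Qed.

Lemma f1_in01 x : in01 x -> in01 (f1 r x).
Proof. intros Hx; pose proof (f1_range x Hx); unfold in01; lra. Qed.

Lemma w0_bounds x : in01 x -> 0 < w0 r x <= / (2 - r).
Proof.
  intros Hx; pose proof (branch_den_bounds x Hx) as Hd; unfold w0.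
  split; [apply Rdiv_lt_0_compat; nra|].
  apply <- Rle_div_l; [|nra].
  apply Rmult_le_reg_l with (2 - r); [lra|]. rewrite <- Rmult_assoc, Rinv_r by lra. nra.
Qed.

Lemma T_f0 x : in01 x -> T r (f0 r x) = x.
Proof.
  intros Hx; pose proof (branch_den_bounds x Hx); pose proof (f0_range x Hx).
  unfold T; destruct (Rle_dec _ _); [|lra].
  unfold f0; field; split; [lra|].
  replace (2 - r + r * x - r * x) with (2 - r) by ring; lra.
Qed.

Lemma T_reflect x : T r (1 - x) = T r x.
Proof.
  unfold T; destruct (Rle_dec (1 - x) (1/2)), (Rle_dec x (1/2)); try lra.
  - replace x with (1/2) by lra. f_equal; lra.
  - replace (1 - r * (1 - x)) with (1 - r + r * x) by ring; reflexivity.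
  - replace (1 - (1 - x)) with x by ring.
    replace (1 - r + r * (1 - x)) with (1 - r * x) by ring; reflexivity.
Qed.

Lemma T_f1 x : in01 x -> T r (f1 r x) = x.
Proof. intros Hx; rewrite f1_reflect, T_reflect by auto; apply T_f0; auto. Qed.

Lemma f0_T x : 0 <= x <= 1 / 2 -> in01 (T r x) /\ f0 r (T r x) = x.
Proof.
  intros Hx. assert (Hd : 0 < 1 - r * x) by nra.
  unfold T; destruct (Rle_dec _ _); [|lra]. split; [split|].
  - apply Rdiv_le_0_compat; nra.
  - apply <- Rle_div_l; nra.
  - unfold f0; field; split; [lra|]. intros E; nra.
Qed.

Lemma f1_T x : 1 / 2 <= x <= 1 -> in01 (T r x) /\ f1 r (T r x) = x.
Proof.
  intros Hx; destruct (f0_T (1 - x)) as [HT Hf]; [lra|].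
  rewrite T_reflect in HT, Hf; split; [auto|]. rewrite f1_reflect, Hf by auto; ring.
Qed.

Lemma T_in01 x : in01 x -> in01 (T r x).
Proof. intros [Hlo Hhi]; destruct (Rle_dec x (1/2)); [apply f0_T | apply f1_T]; lra. Qed.

Lemma T_preimage x : in01 x -> x = f0 r (T r x) \/ x = f1 r (T r x).
Proof.
  intros [Hlo Hhi]; destruct (Rle_dec x (1/2)).
  - left; symmetry; apply f0_T; lra.
  - right; symmetry; apply f1_T; lra.
Qed.

Lemma f0_T_le x : in01 x -> f0 r (T r x) <= x.
Proof.
  intros Hx; pose proof (f0_range (T r x) (T_in01 x Hx)).
  destruct (T_preimage x Hx) as [E|E]; [lra|].
  pose proof (f1_range (T r x) (T_in01 x Hx)); lra.
Qed.

Definition orbit (x : R) (n : nat) : R := Nat.iter n (T r) x.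

Lemma orbit_in01 x n : in01 x -> in01 (orbit x n).
Proof. intros Hx; induction n; simpl; auto using T_in01. Qed.

Lemma orbit_succ x n : orbit x (S n) = T r (orbit x n).
Proof. reflexivity. Qed.

Lemma orbit_succ_r x n : orbit x (S n) = orbit (T r x) n.
Proof. apply Nat.iter_succ_r. Qed.

Definition transfer (f : R -> R) (x : R) : R := w0 r x * (f (f0 r x) + f (f1 r x)).

Definition transfer_iter (n : nat) : (R -> R) -> R -> R := Nat.iter n transfer.

Lemma transfer_iter_succ n f x :
  transfer_iter (S n) f x = w0 r x * (transfer_iter n f (f0 r x) + transfer_iter n f (f1 r x)).
Proof. reflexivity. Qed.

Lemma transfer_iter_succ_r n f x : transfer_iter (S n) f x = transfer_iter n (transfer f) x.
Proof. unfold transfer_iter; rewrite Nat.iter_succ_r; reflexivity. Qed.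

Lemma transfer_iter_le n f g x : in01 x ->
  (forall z, in01 z -> orbit z n = x -> f z <= g z) -> transfer_iter n f x <= transfer_iter n g x.
Proof.
  revert x; induction n as [|n IH]; intros x Hx Hfg; [apply Hfg; auto|].
  rewrite !transfer_iter_succ. pose proof (w0_bounds x Hx).
  apply Rmult_le_compat_l; [lra|]. apply Rplus_le_compat; apply IH.
  - apply f0_in01; auto.
  - intros z Hz E; apply Hfg; auto. rewrite orbit_succ, E; apply T_f0; auto.
  - apply f1_in01; auto.
  - intros z Hz E; apply Hfg; auto. rewrite orbit_succ, E; apply T_f1; auto.
Qed.

Lemma transfer_iter_ext n f g x : in01 x ->
  (forall z, in01 z -> f z = g z) -> transfer_iter n f x = transfer_iter n g x.
Proof.
  intros Hx Hfg; apply Rle_antisym; apply transfer_iter_le; auto;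
    intros z Hz _; rewrite Hfg; auto; lra.
Qed.

Lemma transfer_iter_linear n a b f g x :
  transfer_iter n (fun z => a * f z + b * g z) x =
  a * transfer_iter n f x + b * transfer_iter n g x.
Proof.
  revert x; induction n as [|n IH]; intros x; [reflexivity|].
  rewrite !transfer_iter_succ, !IH; ring.
Qed.

Lemma transfer_iter_scal n a f x :
  transfer_iter n (fun z => a * f z) x = a * transfer_iter n f x.
Proof.
  revert x; induction n as [|n IH]; intros x; [reflexivity|].
  rewrite !transfer_iter_succ, !IH; ring.
Qed.

Lemma escale_PInf c : 0 < c -> escale c PInf = PInf.
Proof. intros; simpl; destruct (Req_EM_T c 0); [lra|reflexivity]. Qed.

Lemma PFn_finite n v x : in01 x ->
  (forall z, in01 z -> orbit z n = x -> exists y, v z = Fin y) ->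
  PFn r n v x = Fin (transfer_iter n (fun y => ereal (v y)) x).
Proof.
  revert x; induction n as [|n IH]; intros x Hx Hv.
  { simpl; destruct (Hv x Hx eq_refl) as [y ->]; reflexivity. }
  simpl PFn; unfold PF. change (w1 r x) with (w0 r x). rewrite !IH, transfer_iter_succ.
  - simpl; f_equal; ring.
  - apply f1_in01; auto.
  - intros z Hz E; apply Hv; auto. rewrite orbit_succ, E; apply T_f1; auto.
  - apply f0_in01; auto.
  - intros z Hz E; apply Hv; auto. rewrite orbit_succ, E; apply T_f0; auto.
Qed.

Lemma PFn_ge n v f x : in01 x -> (forall z, in01 z -> ege (v z) (f z)) ->
  ege (PFn r n v x) (transfer_iter n f x).
Proof.
  intros Hx Hv; revert x Hx; induction n as [|n IH]; intros x Hx; [apply Hv; auto|].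
  pose proof (w0_bounds x Hx) as Hw.
  pose proof (IH _ (f0_in01 x Hx)). pose proof (IH _ (f1_in01 x Hx)).
  rewrite transfer_iter_succ; simpl PFn; unfold PF; change (w1 r x) with (w0 r x).
  destruct (PFn r n v (f0 r x)), (PFn r n v (f1 r x));
    rewrite ?escale_PInf by apply Hw; simpl in *; auto. nra.
Qed.

Lemma PFn_orbit_infinite n v b : in01 b -> v b = PInf -> PFn r n v (orbit b n) = PInf.
Proof.
  intros Hb Hv; induction n as [|n IH]; [auto|].
  pose proof (orbit_in01 b n Hb) as Hy. rewrite orbit_succ. set (y := orbit b n) in *.
  simpl; unfold PF; change (w1 r (T r y)) with (w0 r (T r y)).
  destruct (w0_bounds _ (T_in01 y Hy)) as [Hw _].
  destruct (T_preimage y Hy) as [E|E]; rewrite <- E, IH, escale_PInf by auto.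
  - reflexivity.
  - destruct (escale _ _); reflexivity.
Qed.

(** * Contraction of the variation *)

Lemma h_proportional : exists c, 0 < c /\ forall x, h r x = c / (1 - r + r * x).
Proof.
  unfold h. destruct (Req_EM_T r 0) as [->|Hr0].
  - exists 1; split; [lra|]. intros x. field; lra.
  - pose proof (ln_neg (1 - r) ltac:(lra)). exists (r / - ln (1 - r)); split.
    + apply Rdiv_lt_0_compat; lra.
    + intros x. unfold Rdiv. rewrite Rinv_opp. ring.
Qed.

Lemma h_den_bounds x : in01 x -> 1 - r <= 1 - r + r * x <= 1.
Proof. unfold in01; intros; nra. Qed.

Lemma h_bounds : exists c C, 0 < c <= C /\ forall x, in01 x -> c <= h r x <= C.
Proof.
  destruct h_proportional as (c & Hc & E). exists c, (c / (1 - r)).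
  split; [split; [auto | apply -> Rle_div_r; nra]|].
  intros x Hx; rewrite E; pose proof (h_den_bounds x Hx). split.
  - apply -> Rle_div_r; nra.
  - apply Rmult_le_compat_l; [lra|]. apply Rinv_le_contravar; lra.
Qed.

Lemma h_pos x : in01 x -> 0 < h r x.
Proof. destruct h_bounds as (c & C & Hc & Hh). intros Hx; pose proof (Hh x Hx); lra. Qed.

Lemma bounded_variation_h : bounded_variation 0 1 (h r).
Proof.
  destruct h_proportional as (c & Hc & E). exists (fun x => - h r x). intros x y Hx Hxy Hy.
  assert (h r y <= h r x).
  { rewrite !E. apply Rmult_le_compat_l; [lra|]. apply Rinv_le_contravar; nra. }
  rewrite Rabs_left1; lra.
Qed.

Lemma bounded_variation_inv_h : bounded_variation 0 1 (fun x => / h r x).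
Proof.
  destruct h_proportional as (c & Hc & E). exists (fun x => / h r x). intros x y Hx Hxy Hy.
  rewrite Rabs_pos_eq; [lra|]. apply Rle_minus_r; rewrite Rplus_0_l.
  apply Rinv_le_contravar; [apply h_pos; split; lra|].
  rewrite !E. apply Rmult_le_compat_l; [lra|]. apply Rinv_le_contravar; nra.
Qed.

(* Conjugating [transfer] by [h] yields a Markov operator: the branches [f0] and [f1] are taken with
   probabilities [1 - prob1 x] and [prob1 x]. *)
Definition prob1 (x : R) : R := (1 - r + r * x) / (2 - r + r * x).

Definition markov (g : R -> R) (x : R) : R :=
  (1 - prob1 x) * g (f0 r x) + prob1 x * g (f1 r x).

Lemma prob1_bounds x : in01 x -> 0 <= prob1 x <= 1.
Proof.
  intros Hx; pose proof (h_den_bounds x Hx). unfold prob1. split.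
  - apply Rdiv_le_0_compat; lra.
  - apply <- Rle_div_l; lra.
Qed.

Lemma prob1_increasing x y : in01 x -> in01 y -> x <= y -> prob1 x <= prob1 y.
Proof.
  intros Hx Hy Hxy; pose proof (branch_den_bounds x Hx). pose proof (branch_den_bounds y Hy).
  assert (E : forall z, in01 z -> prob1 z = 1 - / (2 - r + r * z)).
  { intros z Hz; pose proof (branch_den_bounds z Hz). unfold prob1; field; lra. }
  rewrite !E by auto. apply Rplus_le_compat_l, Ropp_le_contravar, Rinv_le_contravar; nra.
Qed.

Lemma transfer_mult_h g x : in01 x -> transfer (fun y => h r y * g y) x = h r x * markov g x.
Proof.
  intros Hx; destruct h_proportional as (c & Hc & E).
  pose proof (branch_den_bounds x Hx). pose proof (h_den_bounds x Hx).
  assert (Hw0 : w0 r x * h r (f0 r x) = h r x * (1 - prob1 x)).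
  { rewrite !E. replace (1 - r + r * f0 r x) with ((2 - r) * (1 - r + r * x) / (2 - r + r * x))
      by (unfold f0; field; lra). unfold w0, prob1; field; lra. }
  assert (Hw1 : w0 r x * h r (f1 r x) = h r x * prob1 x).
  { rewrite !E. replace (1 - r + r * f1 r x) with ((2 - r) / (2 - r + r * x))
      by (unfold f1; field; lra). unfold w0, prob1; field; lra. }
  unfold transfer, markov. rewrite !Rmult_plus_distr_l, <- !Rmult_assoc, Hw0, Hw1. reflexivity.
Qed.

Lemma transfer_iter_mult_h n g x : in01 x ->
  transfer_iter n (fun y => h r y * g y) x = h r x * Nat.iter n markov g x.
Proof.
  revert g; induction n as [|n IH]; intros g Hx; [reflexivity|].
  rewrite transfer_iter_succ_r, Nat.iter_succ_r, <- IH by auto.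
  apply transfer_iter_ext; auto using transfer_mult_h.
Qed.

(* The branch [f1] reverses the order, so the majorant is reflected there; reflecting it at its
   maximum [g 1] makes its increments also pay for the change of the branch probabilities. *)
Lemma var_majorant_markov f g : var_majorant 0 1 f g ->
  exists g', var_majorant 0 1 (markov f) g' /\ g' 1 - g' 0 = / (2 - r) * (g 1 - g 0).
Proof.
  intros Hfg.
  exists (fun x => (1 - prob1 x) * g (f0 r x) + prob1 x * (2 * g 1 - g (f1 r x))).
  assert (in01 0 /\ in01 1) as [Hin0 Hin1] by (unfold in01; lra).
  split.
  2:{ unfold prob1; rewrite !f1_reflect, f0_0, f0_1, Rminus_0_r by auto.
      replace (1 - 1 / 2) with (1 / 2) by field. field; lra. }
  intros x y Hx0 Hxy Hy1.
  assert (Hx : in01 x) by (split; lra). assert (Hy : in01 y) by (split; lra).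
  pose proof (prob1_bounds y Hy). pose proof (prob1_increasing x y Hx Hy Hxy).
  pose proof (f0_increasing x y Hx Hy Hxy). pose proof (f0_range x Hx). pose proof (f0_range y Hy).
  pose proof (f1_reflect x Hx). pose proof (f1_reflect y Hy).
  pose proof (Hfg (f0 r x) (f0 r y) ltac:(lra) ltac:(lra) ltac:(lra)) as Hbranch0.
  pose proof (Hfg (f1 r y) (f1 r x) ltac:(lra) ltac:(lra) ltac:(lra)) as Hbranch1.
  pose proof (Hfg (f0 r x) (f1 r x) ltac:(lra) ltac:(lra) ltac:(lra)) as Hswitch.
  pose proof (var_majorant_mono 0 1 f g Hfg (f1 r x) 1 ltac:(lra) ltac:(lra) ltac:(lra)).
  replace (markov f y - markov f x) with
    ((1 - prob1 y) * (f (f0 r y) - f (f0 r x)) + - (prob1 y * (f (f1 r x) - f (f1 r y)))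
     + (prob1 y - prob1 x) * (f (f1 r x) - f (f0 r x))) by (unfold markov; ring).
  match goal with |- _ <= ?rhs => replace rhs with
    ((1 - prob1 y) * (g (f0 r y) - g (f0 r x)) + prob1 y * (g (f1 r x) - g (f1 r y))
     + (prob1 y - prob1 x) * (2 * g 1 - g (f1 r x) - g (f0 r x))) by ring end.
  eapply Rle_trans; [apply Rabs_triang|].
  eapply Rle_trans; [apply Rplus_le_compat_r, Rabs_triang|].
  rewrite Rabs_Ropp, !Rabs_mult, (Rabs_pos_eq (1 - prob1 y)), (Rabs_pos_eq (prob1 y)),
    (Rabs_pos_eq (prob1 y - prob1 x)) by lra.
  repeat apply Rplus_le_compat; apply Rmult_le_compat_l; lra.
Qed.

Lemma var_majorant_markov_iter n f g : var_majorant 0 1 f g ->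
  exists g', var_majorant 0 1 (Nat.iter n markov f) g' /\
    g' 1 - g' 0 = (/ (2 - r)) ^ n * (g 1 - g 0).
Proof.
  intros Hfg; induction n as [|n (g' & Hg' & Etot)].
  - exists g; split; [auto | simpl; ring].
  - destruct (var_majorant_markov _ _ Hg') as (g'' & Hg'' & Etot'').
    exists g''; split; [auto | rewrite Etot'', Etot; simpl; ring].
Qed.

Lemma div_h_mult_h f x : in01 x -> h r x * (f x * / h r x) = f x.
Proof. intros Hx; pose proof (h_pos x Hx); field; lra. Qed.

Lemma bounded_variation_transfer f :
  bounded_variation 0 1 f -> bounded_variation 0 1 (transfer f).
Proof.
  intros Hf.
  destruct (bounded_variation_mult _ _ _ _ Hf bounded_variation_inv_h) as [g Hg].
  destruct (var_majorant_markov _ g Hg) as (g' & Hg' & _).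
  destruct (bounded_variation_mult _ _ _ _ bounded_variation_h (ex_intro _ g' Hg')) as [k Hk].
  exists k. apply (var_majorant_ext _ _ _ _ Hk). intros x Hx.
  rewrite <- transfer_mult_h by auto.
  apply (transfer_iter_ext 1); auto using div_h_mult_h.
Qed.

Lemma bounded_variation_transfer_iter n f :
  bounded_variation 0 1 f -> bounded_variation 0 1 (transfer_iter n f).
Proof. intros Hf; induction n; [auto | apply bounded_variation_transfer; auto]. Qed.

Lemma f0_sub_w0_le x y : in01 x -> in01 y ->
  Rabs (f0 r y - f0 r x - w0 r x * (y - x)) <= (y - x) ^ 2.
Proof.
  intros Hx Hy; pose proof (branch_den_bounds x Hx); pose proof (branch_den_bounds y Hy).
  set (d := 2 - r + r * x) in *. set (e := 2 - r + r * y) in *.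
  replace (f0 r y - f0 r x - w0 r x * (y - x)) with (- ((2 - r) * r / (d ^ 2 * e)) * (y - x) ^ 2)
    by (rewrite f0_sub by auto; unfold w0; fold d e;
        replace (r * (y - x)) with (e - d) by (unfold e, d; ring); unfold d, e in *; field; lra).
  rewrite Rabs_mult, Rabs_Ropp, (Rabs_pos_eq ((y - x) ^ 2)) by apply pow2_ge_0.
  rewrite <- (Rmult_1_l ((y - x) ^ 2)) at 2. apply Rmult_le_compat_r; [apply pow2_ge_0|].
  assert (1 <= d ^ 2 * e) by (assert (1 <= d ^ 2) by nra; nra).
  rewrite Rabs_pos_eq by (apply Rdiv_le_0_compat; nra).
  apply <- Rle_div_l; nra.
Qed.

Lemma RInt_branches_error f g M x y : var_majorant 0 1 f g ->
  (forall z, in01 z -> Rabs (f z) <= M) -> in01 x -> in01 y -> x <= y ->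
  Rabs (RInt f (f0 r x) (f0 r y) + RInt f (f1 r y) (f1 r x) - (y - x) * transfer f x) <=
  (y - x) * (g (f0 r y) - g (f0 r x) + (g (f1 r x) - g (f1 r y)) + 2 * M * (y - x)).
Proof.
  intros Hg HM Hx Hy Hxy.
  pose proof (f0_range x Hx). pose proof (f0_range y Hy). pose proof (f0_increasing x y Hx Hy Hxy).
  pose proof (f0_nonexpansive x y Hx Hy Hxy). pose proof (f0_sub_w0_le x y Hx Hy).
  pose proof (f1_reflect x Hx). pose proof (f1_reflect y Hy).
  assert (Herr0 : Rabs (RInt f (f0 r x) (f0 r y) - (y - x) * (w0 r x * f (f0 r x)))
    <= (y - x) * (g (f0 r y) - g (f0 r x) + M * (y - x))).
  { apply (RInt_substitution_error f g 0 1); auto using f0_in01; lra. }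
  assert (Herr1 : Rabs (RInt f (f1 r y) (f1 r x) - (y - x) * (w0 r x * f (f1 r x)))
    <= (y - x) * (g (f1 r x) - g (f1 r y) + M * (y - x))).
  { apply (RInt_substitution_error f g 0 1); auto using f1_in01; try lra.
    replace (f1 r x - f1 r y) with (f0 r y - f0 r x) by lra; auto. }
  apply Rabs_le_between in Herr0, Herr1. unfold transfer. apply Rabs_le. split; lra.
Qed.

Lemma RInt_transfer f : bounded_variation 0 1 f -> RInt (transfer f) 0 1 = RInt f 0 1.
Proof.
  intros Hf. pose proof (bounded_variation_transfer f Hf) as HPf.
  pose proof (ex_RInt_bounded_variation _ 0 1 ltac:(lra) Hf) as If.
  pose proof (ex_RInt_bounded_variation _ 0 1 ltac:(lra) HPf) as IPf.
  destruct Hf as [g Hg], HPf as [k Hk].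
  destruct (var_majorant_bounded 0 1 f g Hg) as [M HM].
  assert (Hdiff : forall (u : R -> R) c d, ex_RInt u 0 1 -> 0 <= c -> c <= d -> d <= 1 ->
    RInt u 0 d - RInt u 0 c = RInt u c d).
  { intros u c d Hu Hc Hcd Hd.
    apply RInt_Chasles_minus; apply (ex_RInt_subinterval _ 0 1); auto; lra. }
  pose (Phi := (fun x => RInt f 0 (f0 r x) - RInt f 0 (f1 r x) - RInt (transfer f) 0 x) : R -> R).
  assert (Heq : Phi 1 = Phi 0).
  { apply eq_of_quadratic_increments
      with (g := fun t => g (f0 r t) - g (f1 r t) + 2 * M * t + k t); [lra|].
    intros x y Hx0 Hxy Hy1.
    assert (Hx : in01 x) by (split; lra). assert (Hy : in01 y) by (split; lra).
    pose proof (f0_range x Hx). pose proof (f0_range y Hy).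
    pose proof (f0_increasing x y Hx Hy Hxy).
    pose proof (f1_reflect x Hx). pose proof (f1_reflect y Hy).
    pose proof (RInt_branches_error f g M x y Hg HM Hx Hy Hxy) as Hbranches.
    pose proof (var_majorant_RInt_approx _ k x y x
      (var_majorant_sub 0 1 _ k Hk x y Hx0 Hy1) ltac:(lra)) as Htransfer.
    pose proof (Hdiff f (f0 r x) (f0 r y) If ltac:(lra) ltac:(lra) ltac:(lra)).
    pose proof (Hdiff f (f1 r y) (f1 r x) If ltac:(lra) ltac:(lra) ltac:(lra)).
    pose proof (Hdiff (transfer f) x y IPf Hx0 Hxy Hy1).
    unfold Phi. apply Rabs_le_between in Hbranches, Htransfer. apply Rabs_le. split; lra. }
  unfold Phi in Heq. rewrite !f1_reflect, f0_0, f0_1, !RInt_point in Heq by (unfold in01; lra).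
  unfold zero in Heq; simpl in Heq.
  replace (1 - 1 / 2) with (1 / 2) in Heq by field. rewrite !Rminus_0_r in Heq. lra.
Qed.

Lemma RInt_transfer_iter n f : bounded_variation 0 1 f ->
  RInt (transfer_iter n f) 0 1 = RInt f 0 1.
Proof.
  intros Hf; induction n as [|n IH]; [auto|]. rewrite <- IH.
  apply RInt_transfer, bounded_variation_transfer_iter; auto.
Qed.

Lemma RInt_h : RInt (h r) 0 1 = 1.
Proof.
  destruct (Req_dec r 0) as [E|Hr0].
  - rewrite (RInt_ext _ (fun _ => 1)).
    + rewrite RInt_const; unfold scal; simpl; unfold mult; simpl; lra.
    + intros; unfold h; destruct (Req_EM_T r 0); lra.
  - pose proof (ln_neg (1 - r) ltac:(lra)).
    set (prim := fun x => - / ln (1 - r) * ln (1 - r + r * x)).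
    assert (Hh : forall x, h r x = - r / ln (1 - r) * (1 / (1 - r + r * x))).
    { intros x; unfold h; destruct (Req_EM_T r 0); [lra | reflexivity]. }
    apply is_RInt_unique. replace 1 with (minus (prim 1) (prim 0)) at 2.
    2:{ unfold prim, minus, plus, opp; simpl. replace (1 - r + r * 1) with 1 by ring.
        replace (1 - r + r * 0) with (1 - r) by ring. rewrite ln_1. field; lra. }
    apply (is_RInt_derive (V := R_CompleteNormedModule) prim); rewrite Rmin_left, Rmax_right by lra;
      intros x Hx; assert (0 < 1 - r + r * x) by nra.
    + unfold prim; auto_derive; [lra|]. rewrite Hh; field; lra.
    + apply continuous_ext with (fun x => - r / ln (1 - r) * (1 / (1 - r + r * x))); auto.
      apply (ex_derive_continuous (V := R_NormedModule)). auto_derive; lra.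
Qed.

Lemma inv_2_minus_bounds : 0 < / (2 - r) < 1.
Proof.
  split; [apply Rinv_0_lt_compat; lra|].
  rewrite <- Rinv_1; apply Rinv_lt_contravar; lra.
Qed.

Lemma RInt_near_mult_h f c e : ex_RInt f 0 1 ->
  (forall x, in01 x -> Rabs (f x - c * h r x) <= e * h r x) -> Rabs (RInt f 0 1 - c) <= e.
Proof.
  intros If Hf.
  pose proof (ex_RInt_bounded_variation _ 0 1 ltac:(lra) bounded_variation_h) as Ih.
  assert (Hscal : forall s, ex_RInt (fun x => s * h r x) 0 1 /\ RInt (fun x => s * h r x) 0 1 = s).
  { intros s; split; [apply (ex_RInt_scal (h r) 0 1 s Ih)|].
    transitivity (s * RInt (h r) 0 1); [apply (RInt_scal (h r) 0 1 s Ih)|].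
    rewrite RInt_h; apply Rmult_1_r. }
  destruct (Hscal (c - e)) as [Ilow Elow], (Hscal (c + e)) as [Iup Eup].
  assert (RInt (fun x => (c - e) * h r x) 0 1 <= RInt f 0 1
    /\ RInt f 0 1 <= RInt (fun x => (c + e) * h r x) 0 1).
  { split; apply RInt_le; auto; try lra; intros x Hx;
      specialize (Hf x ltac:(split; lra)); apply Rabs_le_between in Hf; lra. }
  apply Rabs_le; lra.
Qed.

Lemma transfer_iter_cvg f : bounded_variation 0 1 f -> forall eps, 0 < eps ->
  eventually (fun n => forall x, in01 x ->
    Rabs (transfer_iter n f x - RInt f 0 1 * h r x) < eps).
Proof.
  intros Hf eps Heps. destruct h_bounds as (c & C & _ & HC).
  destruct (bounded_variation_mult _ _ _ _ Hf bounded_variation_inv_h) as [g Hg].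
  set (u := fun x => f x * / h r x) in *.
  pose proof inv_2_minus_bounds as Hq.
  destruct (eventually_geom_lt (/ (2 - r)) ((g 1 - g 0) * C) eps ltac:(lra) Heps) as [N HN].
  exists N; intros n Hn x Hx. specialize (HN n Hn).
  destruct (var_majorant_markov_iter n u g Hg) as (g' & Hg' & Etot).
  set (k := Nat.iter n markov u) in *. set (e := (/ (2 - r)) ^ n * (g 1 - g 0)) in *.
  assert (Efk : forall y, in01 y -> transfer_iter n f y = h r y * k y).
  { intros y Hy. unfold k; rewrite <- transfer_iter_mult_h by auto.
    apply transfer_iter_ext; auto. intros z Hz; unfold u; symmetry; apply div_h_mult_h; auto. }
  assert (Hmass : Rabs (RInt f 0 1 - k x) <= e).
  { rewrite <- (RInt_transfer_iter n f) by auto. apply RInt_near_mult_h.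
    - apply ex_RInt_bounded_variation; [lra | apply bounded_variation_transfer_iter; auto].
    - intros y Hy. rewrite Efk by auto. replace (h r y * k y - k x * h r y)
        with ((k y - k x) * h r y) by ring.
      pose proof (h_pos y Hy). rewrite Rabs_mult, (Rabs_pos_eq (h r y)) by lra.
      apply Rmult_le_compat_r; [lra|]. rewrite <- Etot. apply (var_majorant_osc 0 1); auto. }
  rewrite Efk by auto. replace (h r x * k x - RInt f 0 1 * h r x)
    with (- ((RInt f 0 1 - k x) * h r x)) by ring.
  pose proof (h_pos x Hx). pose proof (HC x Hx).
  rewrite Rabs_Ropp, Rabs_mult, (Rabs_pos_eq (h r x)) by lra.
  apply Rle_lt_trans with (e * C); [|unfold e; lra].
  apply Rmult_le_compat; auto using Rabs_pos; lra.
Qed.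

Lemma transfer_iter_h n x : in01 x -> transfer_iter n (h r) x = h r x.
Proof.
  intros Hx; induction n as [|n IH]; [reflexivity|].
  rewrite transfer_iter_succ_r, <- IH. apply transfer_iter_ext; auto. intros z Hz.
  transitivity (transfer (fun y => h r y * 1) z); [unfold transfer; ring|].
  rewrite transfer_mult_h by auto. unfold markov; ring.
Qed.

Lemma transfer_iter_1_bounded : exists B, 0 < B /\ forall n x, in01 x ->
  0 <= transfer_iter n (fun _ => 1) x <= B.
Proof.
  destruct h_bounds as (c & C & Hc & Hh).
  assert (Hic : 0 < / c) by (apply Rinv_0_lt_compat; lra).
  exists (/ c * C). split; [apply Rmult_lt_0_compat; lra|]. intros n x Hx. split.
  - rewrite <- (Rmult_0_l (transfer_iter n (h r) x)), <- transfer_iter_scal.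
    apply transfer_iter_le; auto; intros; lra.
  - apply Rle_trans with (/ c * h r x).
    + rewrite <- (transfer_iter_h n x Hx), <- transfer_iter_scal.
      apply transfer_iter_le; auto. intros z Hz _.
      rewrite <- (Rinv_l c) by lra. apply Rmult_le_compat_l; [lra | apply Hh; auto].
    + apply Rmult_le_compat_l; [lra | apply Hh; auto].
Qed.

(** * The pole along its orbit *)

(* Foster-Lyapunov drift condition, with the drift following the orbit of the parameter [c]. *)
Lemma transfer_iter_drift (V : R -> R -> R) q K : 0 <= q < 1 -> 0 <= K ->
  (forall c x, in01 c -> in01 x -> x <> T r c -> transfer (V c) x <= q * V (T r c) x + K) ->
  exists B, forall n c x, in01 c -> in01 x -> x <> orbit c n ->
    transfer_iter n (V c) x <= q ^ n * V (orbit c n) x + B.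
Proof.
  intros Hq HK Hdrift. destruct transfer_iter_1_bounded as (B & HB & Hone).
  set (B' := K * B / (1 - q)).
  assert (HB' : 0 <= B') by (apply Rdiv_le_0_compat; nra).
  exists B'; induction n as [|n IH]; intros c x Hc Hx Hne; [simpl; lra|].
  rewrite orbit_succ_r in *.
  rewrite transfer_iter_succ_r.
  apply Rle_trans with (transfer_iter n (fun z => q * V (T r c) z + K * 1) x).
  { apply transfer_iter_le; auto. intros z Hz Ez. rewrite Rmult_1_r. apply Hdrift; auto.
    intros ->; auto. }
  rewrite (transfer_iter_linear n q K (V (T r c)) (fun _ => 1)).
  specialize (IH (T r c) x (T_in01 c Hc) Hx Hne). specialize (Hone n x Hx).
  replace (q ^ S n * V (orbit (T r c) n) x + B')
    with (q * (q ^ n * V (orbit (T r c) n) x + B') + K * B) by (unfold B'; simpl; field; lra).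
  apply Rplus_le_compat; apply Rmult_le_compat_l; lra.
Qed.

Section Pole.

Variable a : R.
Hypothesis Ha : 0 < a < 1.

Definition pole (c x : R) : R := Rpower (Rabs (x - c)) (- a).

(* When the two inverse branches separate [x] from the pole, the singularity survives only if both
   points approach the common image [1] of the branch point, and then both move on to [0]. *)
Definition corner1 (c x : R) : R := Rpower (2 - x - c) (- a).
Definition corner0 (c x : R) : R := Rpower (x + c) (- a).

Definition pole_rate : R := Rpower (/ (2 - r)) (1 - a).
Definition far_bound : R := Rpower (/ 4) (- a).

Lemma pole_rate_bounds : 0 < pole_rate < 1.
Proof.
  pose proof inv_2_minus_bounds. split; [apply exp_pos | apply Rpower_lt_1; lra].
Qed.

Lemma w0_mult_far_le x y : in01 x -> 1 / 2 <= y -> w0 r x * Rpower y (- a) <= far_bound.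
Proof.
  intros Hx Hy. pose proof (w0_bounds x Hx). pose proof inv_2_minus_bounds.
  rewrite <- (Rmult_1_l far_bound). apply Rmult_le_compat; try lra; [left; apply exp_pos|].
  apply Rpower_opp_le; lra.
Qed.

Lemma w0_mult_pole_le x c : in01 x -> in01 c -> x <> c ->
  w0 r x * pole (f0 r c) (f0 r x) <= pole_rate * (1 + pole c x).
Proof.
  intros Hx Hc Hne. pose proof (branch_den_bounds x Hx). pose proof (branch_den_bounds c Hc).
  assert (Hu : 0 < Rabs (x - c)) by (apply Rabs_pos_lt; lra).
  apply weighted_Rpower_le; auto using w0_bounds; [lra|].
  rewrite f0_sub by auto.
  unfold Rdiv at 2.
  rewrite !Rabs_mult, Rabs_inv, (Rabs_pos_eq (2 - r)), (Rabs_pos_eq (_ * _)) by nra.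
  set (u := Rabs (x - c)) in *. unfold w0.
  assert (Hdist : 2 - r + r * c <= (2 - r + r * x) * (1 + u)).
  { assert (c - x <= u) by (unfold u; rewrite Rabs_minus_sym; apply Rle_abs). nra. }
  set (d := 2 - r + r * x) in *. set (e := 2 - r + r * c) in *.
  replace ((2 - r) / d ^ 2 * (u / (1 + u))) with ((2 - r) * u * / (d * (d * (1 + u))))
    by (field; lra).
  apply Rmult_le_compat_l; [nra|]. apply Rinv_le_contravar; nra.
Qed.

Lemma w0_mult_corner0_le x c y : in01 x -> in01 c -> x <> c -> f0 r x + f0 r c <= y ->
  w0 r x * Rpower y (- a) <= pole_rate * (1 + corner0 c x).
Proof.
  intros Hx Hc Hne Hy.
  assert (Hs : 0 < x + c) by (unfold in01 in *; destruct (Req_dec x 0), (Req_dec c 0); lra).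
  pose proof (w0_bounds x Hx) as Hw.
  apply weighted_Rpower_le; auto; [lra|].
  eapply Rle_trans; [|apply Hy].
  apply Rle_trans with (/ (2 - r) * ((x + c) / (1 + (x + c)))).
  { apply Rmult_le_compat_r; [apply Rdiv_le_0_compat; lra | apply Hw]. }
  assert (Hf0 : forall z, in01 z -> z <= x + c -> z * / ((2 - r) * (1 + (x + c))) <= f0 r z).
  { intros z Hz Hle. pose proof (branch_den_bounds z Hz). unfold f0, Rdiv.
    apply Rmult_le_compat_l; [apply Hz|]. apply Rinv_le_contravar; [lra|].
    destruct Hz. nra. }
  destruct (Hx) as [Hx0 _], (Hc) as [Hc0 _].
  pose proof (Hf0 x Hx ltac:(lra)). pose proof (Hf0 c Hc ltac:(lra)).
  replace (/ (2 - r) * ((x + c) / (1 + (x + c)))) with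
    (x * / ((2 - r) * (1 + (x + c))) + c * / ((2 - r) * (1 + (x + c)))) by (field; lra).
  lra.
Qed.

Lemma half_sub_f0_ge x : in01 x -> (1 - x) / 4 <= 1 / 2 - f0 r x.
Proof.
  intros Hx; pose proof (branch_den_bounds x Hx) as Hd.
  rewrite <- f0_1, f0_sub by (auto; unfold in01; lra).
  replace (2 - r + r * 1) with 2 by ring. destruct Hx.
  apply -> Rle_div_r; nra.
Qed.

Lemma transfer_pole_f0_le c x : in01 c -> in01 x -> x <> c ->
  transfer (pole (f0 r c)) x <= pole_rate * (1 + pole c x) + far_bound * corner1 c x.
Proof.
  intros Hc Hx Hne. unfold transfer. rewrite Rmult_plus_distr_l.
  apply Rplus_le_compat; [apply w0_mult_pole_le; auto|].
  pose proof (w0_bounds x Hx). pose proof inv_2_minus_bounds.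
  pose proof (half_sub_f0_ge x Hx). pose proof (half_sub_f0_ge c Hc).
  assert (Hs : 0 < 2 - x - c) by (unfold in01 in *; destruct (Req_dec x 1), (Req_dec c 1); lra).
  rewrite <- (Rmult_1_l (far_bound * _)).
  apply Rmult_le_compat; try lra; [left; apply exp_pos|].
  unfold far_bound, corner1. rewrite Rpower_mult_distr by lra.
  apply Rpower_opp_le; [lra|]. split; [lra|].
  rewrite f1_reflect by auto. eapply Rle_trans; [|apply Rle_abs]. lra.
Qed.

Lemma transfer_pole_le c x : in01 c -> in01 x -> x <> T r c ->
  transfer (pole c) x <= pole_rate * (1 + pole (T r c) x) + far_bound * corner1 (T r c) x.
Proof.
  intros Hc Hx Hne. pose proof (T_in01 c Hc) as HTc.
  replace (transfer (pole c) x) with (transfer (pole (f0 r (T r c))) x);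
    [apply transfer_pole_f0_le; auto|].
  destruct (T_preimage c Hc) as [E|E]; [rewrite <- E; reflexivity|].
  (* [pole (1 - c)] is [pole c] reflected, and reflection exchanges the two branches. *)
  rewrite f1_reflect in E by auto. unfold transfer, pole. rewrite f1_reflect by auto.
  replace (f0 r (T r c)) with (1 - c) by lra.
  rewrite (Rabs_minus_sym (f0 r x) c), (Rabs_minus_sym (1 - f0 r x) c).
  replace (f0 r x - (1 - c)) with (c - (1 - f0 r x)) by ring.
  replace (1 - f0 r x - (1 - c)) with (c - f0 r x) by ring. ring.
Qed.

Lemma transfer_corner1_le c x : in01 c -> in01 x -> x <> T r c ->
  transfer (corner1 c) x <= pole_rate * (1 + corner0 (T r c) x) + far_bound.
Proof.
  intros Hc Hx Hne. pose proof (T_in01 c Hc) as HTc.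
  pose proof (f0_range x Hx). pose proof (f1_reflect x Hx).
  assert (f0 r (T r c) <= 1 - c).
  { rewrite <- T_reflect. apply f0_T_le. unfold in01 in *; lra. }
  unfold transfer. rewrite (Rplus_comm (corner1 c _)), Rmult_plus_distr_l. destruct Hc.
  apply Rplus_le_compat;
    [apply w0_mult_corner0_le | apply w0_mult_far_le]; auto; lra.
Qed.

Lemma transfer_corner0_le c x : in01 c -> in01 x -> x <> T r c ->
  transfer (corner0 c) x <= pole_rate * (1 + corner0 (T r c) x) + far_bound.
Proof.
  intros Hc Hx Hne. pose proof (T_in01 c Hc). pose proof (f0_T_le c Hc). pose proof (f1_range x Hx).
  unfold transfer. rewrite Rmult_plus_distr_l. destruct Hc.
  apply Rplus_le_compat; [apply w0_mult_corner0_le | apply w0_mult_far_le]; auto; lra.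
Qed.

Lemma corners_le_pole c x : in01 c -> in01 x -> x <> c ->
  corner1 c x <= pole c x /\ corner0 c x <= pole c x.
Proof.
  intros Hc Hx Hne. assert (0 < Rabs (x - c)) by (apply Rabs_pos_lt; lra).
  assert (Rabs (x - c) <= 2 - x - c /\ Rabs (x - c) <= x + c).
  { unfold in01 in *; split; unfold Rabs; destruct (Rcase_abs _); lra. }
  split; apply Rpower_opp_le; lra.
Qed.

Lemma pow_mult_pole_le q n c x dist : 0 < q < 1 -> 0 < dist <= Rabs (x - c) ->
  q ^ n * pole c x <= Rpower dist (- a).
Proof.
  intros Hq Hdist. rewrite <- (Rmult_1_l (Rpower dist _)).
  apply Rmult_le_compat; [apply pow_le; lra | left; apply exp_pos | | apply Rpower_opp_le; lra].
  rewrite <- (pow1 n); apply pow_incr; lra.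
Qed.

Definition lyapunov (A B c x : R) : R := pole c x + A * corner1 c x + B * corner0 c x.

Lemma ex_lyapunov_drift : exists A B q K, 0 < A /\ 0 < B /\ 0 < q < 1 /\ 0 < K /\
  forall c x, in01 c -> in01 x -> x <> T r c ->
  transfer (lyapunov A B c) x <= q * lyapunov A B (T r c) x + K.
Proof.
  pose proof pole_rate_bounds as Hrate. assert (Hfar : 0 < far_bound) by apply exp_pos.
  set (q := (1 + pole_rate) / 2). assert (Hq : pole_rate < q < 1) by (unfold q; lra).
  set (A := far_bound / q). set (B := A * pole_rate / (q - pole_rate)).
  assert (HA : 0 < A) by (apply Rdiv_lt_0_compat; lra).
  assert (HB : 0 < B) by (apply Rdiv_lt_0_compat; nra).
  exists A, B, q, (pole_rate + (A + B) * (pole_rate + far_bound)).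
  split; [auto|]. split; [auto|]. split; [lra|]. split; [nra|].
  intros c x Hc Hx Hne.
  replace (transfer (lyapunov A B c) x) with
    (transfer (pole c) x + A * transfer (corner1 c) x + B * transfer (corner0 c) x)
    by (unfold transfer, lyapunov; ring).
  pose proof (transfer_pole_le c x Hc Hx Hne).
  pose proof (Rmult_le_compat_l A _ _ ltac:(lra) (transfer_corner1_le c x Hc Hx Hne)).
  pose proof (Rmult_le_compat_l B _ _ ltac:(lra) (transfer_corner0_le c x Hc Hx Hne)).
  assert (pole_rate * pole (T r c) x <= q * pole (T r c) x)
    by (apply Rmult_le_compat_r; [left; apply exp_pos | lra]).
  replace (q * lyapunov A B (T r c) x) with (q * pole (T r c) x
    + far_bound * corner1 (T r c) x + (A + B) * pole_rate * corner0 (T r c) x)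
    by (unfold lyapunov, B, A; field; lra).
  lra.
Qed.

Lemma transfer_iter_pole_le : exists C q, 0 < C /\ 0 < q < 1 /\ forall n c x,
  in01 c -> in01 x -> x <> orbit c n ->
  transfer_iter n (pole c) x <= C * (1 + q ^ n * pole (orbit c n) x).
Proof.
  destruct ex_lyapunov_drift as (A & B & q & K & HA & HB & Hq & HK & Hdrift).
  destruct (transfer_iter_drift (lyapunov A B) q K) as [D HD]; [lra..|auto|].
  exists (1 + A + B + Rabs D), q. pose proof (Rabs_pos D). pose proof (Rle_abs D).
  split; [lra|]. split; [lra|]. intros n c x Hc Hx Hne.
  apply Rle_trans with (transfer_iter n (lyapunov A B c) x).
  { apply transfer_iter_le; auto. intros z _ _.
    assert (0 < corner1 c z) by apply exp_pos. assert (0 < corner0 c z) by apply exp_pos.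
    unfold lyapunov; nra. }
  eapply Rle_trans; [apply HD; auto|].
  destruct (corners_le_pole (orbit c n) x) as [Hle1 Hle0]; auto using orbit_in01.
  assert (Hpole : 0 < pole (orbit c n) x) by apply exp_pos.
  pose proof (pow_lt q n ltac:(lra)).
  assert (q ^ n * lyapunov A B (orbit c n) x <= q ^ n * ((1 + A + B) * pole (orbit c n) x))
    by (apply Rmult_le_compat_l; unfold lyapunov; nra).
  assert (0 < q ^ n * pole (orbit c n) x) by nra. nra.
Qed.

End Pole.

(** * Limit sets of orbits *)

Lemma omega_limit_ValAdh b x : omega_limit r b x <-> ValAdh (orbit b) x.
Proof.
  split; intros Hx.
  { intros V N HV. destruct (Hx N V HV) as (y & HVy & n & Hn & ->). exists n; auto. }
  intros k V HV. destruct (Hx V k HV) as (n & Hn & HVn).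
  exists (orbit b n); split; auto. exists n; auto.
Qed.

Lemma orbit_periodic b m : preperiodic_m r b m ->
  exists n0, forall n j, (n0 <= n)%nat -> orbit b (n + j * m) = orbit b n.
Proof.
  intros (Hm & n0 & Hper). exists n0. intros n j Hn. induction j as [|j IH]; [f_equal; lia|].
  rewrite <- IH. specialize (Hper (n - n0 + j * m)%nat). symmetry. unfold orbit.
  replace (n + j * m)%nat with (n0 + (n - n0 + j * m))%nat by lia. rewrite Hper. f_equal; lia.
Qed.

Lemma omega_limit_preperiodic b m x : preperiodic_m r b m -> omega_limit r b x ->
  forall N, exists n, (N <= n)%nat /\ orbit b n = x.
Proof.
  intros Hm Hx. destruct (orbit_periodic b m Hm) as [n0 Hper]. destruct Hm as [Hm _].
  apply ValAdh_finite_range with (map (orbit b) (seq n0 m)); [apply omega_limit_ValAdh; auto|].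
  exists n0; intros n Hn.
  pose proof (Nat.div_mod (n - n0) m ltac:(lia)).
  pose proof (Nat.mod_upper_bound (n - n0) m ltac:(lia)).
  apply in_map_iff. exists (n0 + (n - n0) mod m)%nat. split; [|apply in_seq; lia].
  rewrite <- (Hper _ ((n - n0) / m)%nat) by lia. f_equal; lia.
Qed.

Lemma omega_limit_preperiodic_in01 b m x :
  in01 b -> preperiodic_m r b m -> omega_limit r b x -> in01 x.
Proof.
  intros Hb Hm Hx. destruct (omega_limit_preperiodic b m x Hm Hx 0) as (n & _ & <-).
  apply orbit_in01; auto.
Qed.

Lemma orbit_frequently_ne b p x n0 : period_length r b p -> (1 < p)%nat ->
  exists n, (n0 <= n)%nat /\ orbit b n <> x.
Proof.
  intros [_ Hmin] Hp.
  destruct (eventually_or_frequently_not (fun n => orbit b n = x)) as [[N HN]|Hne]; [|apply Hne].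
  assert (p <= 1)%nat; [|lia]. apply Hmin. split; [lia|]. exists N; intros k.
  fold (orbit b (N + k)) (orbit b (N + 1 + k)). rewrite !HN by lia; auto.
Qed.

(** * Convergence for densities with a pole *)

Definition cvg_off_pole (b : R) (v : R -> ER) (I a q : R) : Prop := forall B eps, 0 < eps ->
  eventually (fun n => forall x, in01 x -> x <> orbit b n ->
    q ^ n * pole a (orbit b n) x <= B -> eclose (PFn r n v x) (I * h r x) eps).

Section PoleDensity.

Variables (alpha b : R) (v : R -> ER).
Hypothesis Halpha : 0 < alpha < 1.
Hypothesis Hb : in01 b.
Hypothesis Hv : in_U b alpha v.

Lemma density_finite z : in01 z -> z <> b -> exists y, v z = Fin y.
Proof.
  intros Hz Hne. destruct Hv as (_ & _ & Hbv & _).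
  assert (Hd : 0 < Rabs (z - b)) by (apply Rabs_pos_lt; lra).
  destruct (Hbv _ (compact_away 0 1 b _ Hd) (fun x => away_ne 0 1 b _ x Hd)) as [Hfin _].
  apply Hfin; split; [auto | lra].
Qed.

Lemma density_nonneg z : in01 z -> 0 <= ereal (v z).
Proof.
  intros Hz. destruct Hv as (Hn & _). specialize (Hn z Hz). destruct (v z); simpl in *; lra.
Qed.

Definition truncation (d : R) : R -> R := cutoff (fun y => ereal (v y)) b d.

Definition truncated_mass (d : R) : R := RInt (truncation d) 0 1.

Lemma truncation_bounds d z : in01 z -> 0 <= truncation d z <= ereal (v z).
Proof. intros Hz. apply (cutoff_bounds (fun y => ereal (v y))), density_nonneg; auto. Qed.

Lemma truncation_ege d z : in01 z -> ege (v z) (truncation d z).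
Proof.
  intros Hz; pose proof (truncation_bounds d z Hz). destruct (v z); simpl in *; auto; lra.
Qed.

Lemma bounded_variation_truncation d : 0 < d -> bounded_variation 0 1 (truncation d).
Proof.
  intros Hd. destruct Hv as (_ & _ & Hbv & _).
  destruct (Hbv _ (compact_away 0 1 b d Hd) (fun x => away_ne 0 1 b d x Hd))
    as (_ & [M HM] & [W HW] & _).
  destruct (var_majorant_of_variation _ _ W HW) as (V & Vmono & HV).
  apply bounded_variation_cutoff with V M; auto.
Qed.

Lemma ex_RInt_truncation d : 0 < d -> ex_RInt (truncation d) 0 1.
Proof.
  intros Hd; apply ex_RInt_bounded_variation; [lra | apply bounded_variation_truncation; auto].
Qed.

Lemma truncated_mass_antitone d d' : 0 < d -> d <= d' -> truncated_mass d' <= truncated_mass d.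
Proof.
  intros Hd Hdd'. apply RInt_le; try apply ex_RInt_truncation; try lra.
  intros x Hx; apply cutoff_antitone; auto. apply density_nonneg; split; lra.
Qed.

Lemma density_le_truncation_plus_pole a : alpha < a ->
  exists d0 C, 0 < d0 /\ 0 < C /\ forall d, 0 < d <= d0 -> forall y, in01 y -> y <> b ->
  ereal (v y) <= truncation d y + C * Rpower d (a - alpha) * pole a b y.
Proof.
  intros Ha. destruct Hv as (_ & _ & _ & (d0 & C1 & C2 & Hd0 & _ & HC2 & _ & Hbound)).
  exists d0, C2. split; [lra|]. split; [lra|]. intros d Hd y Hy Hne.
  pose proof (Rabs_pos_lt (y - b) ltac:(lra)) as Hpos.
  assert (0 < C2 * Rpower d (a - alpha) * pole a b y)
    by (apply Rmult_lt_0_compat; [apply Rmult_lt_0_compat; [lra|]|]; apply exp_pos).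
  unfold truncation, cutoff; destruct (Rlt_dec (Rabs (y - b)) d) as [Hnear|_]; [|lra].
  destruct (Hbound y Hy ltac:(lra)) as [_ Hle]. rewrite Rabs_minus_sym in Hle.
  rewrite Rplus_0_l. apply Rle_trans with (C2 * Rpower (Rabs (y - b)) (- alpha)).
  { destruct (v y); simpl in *; [auto | tauto]. }
  rewrite Rmult_assoc. apply Rmult_le_compat_l; [lra|].
  replace (- alpha) with ((a - alpha) + - a) by ring. rewrite Rpower_plus.
  apply Rmult_le_compat_r; [left; apply exp_pos|]. apply Rle_Rpower_l; lra.
Qed.

(* The part of [v] within distance [d] of its pole is at most [d ^ (a - alpha)] times the steeper
   pole [|. - b| ^ (- a)], so its contribution to [P^n v] is small with [d]. *)
Lemma transfer_iter_density_le a : alpha < a < 1 ->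
  exists q d0 C, 0 < q < 1 /\ 0 < d0 /\ 0 < C /\
  forall d n x, 0 < d <= d0 -> in01 x -> x <> orbit b n ->
  transfer_iter n (fun y => ereal (v y)) x <=
  transfer_iter n (truncation d) x + C * Rpower d (a - alpha) * (1 + q ^ n * pole a (orbit b n) x).
Proof.
  intros Ha. destruct (density_le_truncation_plus_pole a ltac:(lra)) as (d0 & C0 & Hd0 & HC0 & Hle).
  destruct (transfer_iter_pole_le a ltac:(lra)) as (C & q & HC & Hq & Hpole).
  exists q, d0, (C0 * C). split; [auto|]. split; [auto|]. split; [nra|].
  intros d n x Hd Hx Hne. set (L := C0 * Rpower d (a - alpha)).
  assert (HL : 0 < L) by (apply Rmult_lt_0_compat; [auto | apply exp_pos]).
  apply Rle_trans with (transfer_iter n (fun z => 1 * truncation d z + L * pole a b z) x).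
  - apply transfer_iter_le; auto. intros z Hz Ez. rewrite Rmult_1_l. apply Hle; auto.
    intros ->; auto.
  - rewrite transfer_iter_linear, Rmult_1_l. apply Rplus_le_compat_l.
    replace (C0 * C * Rpower d (a - alpha)) with (L * C) by (unfold L; ring).
    rewrite Rmult_assoc. apply Rmult_le_compat_l; [lra|]. apply Hpole; auto.
Qed.

Lemma transfer_iter_truncation_bounded : exists M, 0 < M /\ forall d n x, in01 x ->
  1 / 2 <= Rabs (x - orbit b n) -> transfer_iter n (truncation d) x <= M.
Proof.
  set (a := (1 + alpha) / 2).
  destruct (transfer_iter_density_le a ltac:(unfold a; lra)) as (q & d0 & C & Hq & Hd0 & HC & Hle).
  destruct (bounded_variation_truncation d0 Hd0) as [g Hg].
  destruct (var_majorant_bounded 0 1 _ g Hg) as [N HN].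
  destruct transfer_iter_1_bounded as (B & HB & Hone).
  set (s := Rpower (1 / 2) (- a)). assert (Hs : 0 < s) by apply exp_pos.
  set (L := C * Rpower d0 (a - alpha)).
  assert (HL : 0 < L) by (apply Rmult_lt_0_compat; [auto | apply exp_pos]).
  assert (HN0 : 0 <= N) by (eapply Rle_trans; [apply Rabs_pos | apply (HN 0); lra]).
  exists (N * B + L * (1 + s)). split; [nra|]. intros d n x Hx Hfar.
  assert (Hne : x <> orbit b n) by (apply ne_of_Rabs_minus_ge with (1 / 2); auto; lra).
  apply Rle_trans with (transfer_iter n (fun y => ereal (v y)) x).
  { apply transfer_iter_le; auto. intros z Hz _. apply truncation_bounds; auto. }
  eapply Rle_trans; [apply (Hle d0); auto; lra|]. apply Rplus_le_compat.
  - apply Rle_trans with (N * transfer_iter n (fun _ => 1) x).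
    + rewrite <- transfer_iter_scal. apply transfer_iter_le; auto. intros z Hz _.
      rewrite Rmult_1_r. eapply Rle_trans; [apply Rle_abs | apply HN; auto].
    + apply Rmult_le_compat_l; [auto | apply Hone; auto].
  - apply Rmult_le_compat_l; [lra|]. apply Rplus_le_compat_l.
    apply pow_mult_pole_le; [unfold a; lra | auto | lra].
Qed.

(* Evaluating [P^n] at whichever of [0] and [1] is at distance at least [1/2] from [T^n b] bounds
   the truncated masses without integrating the singularity. *)
Lemma truncated_mass_bounded : exists M, forall d, 0 < d -> truncated_mass d <= M.
Proof.
  destruct transfer_iter_truncation_bounded as (M & HM & Hle).
  destruct h_bounds as (c & C & Hc & Hh). exists ((M + 1) / c). intros d Hd.
  destruct (transfer_iter_cvg _ (bounded_variation_truncation d Hd) 1 Rlt_0_1) as [n Hn].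
  assert (exists x, in01 x /\ 1 / 2 <= Rabs (x - orbit b n)) as (x & Hx & Hfar).
  { destruct (orbit_in01 b n Hb).
    destruct (Rle_dec (orbit b n) (1 / 2)); [exists 1 | exists 0]; (split; [unfold in01; lra|]);
      unfold Rabs; destruct (Rcase_abs _); lra. }
  specialize (Hn n (Nat.le_refl n) x Hx). fold (truncated_mass d) in Hn. apply Rabs_def2 in Hn.
  specialize (Hle d n x Hx Hfar). specialize (Hh x Hx).
  apply -> Rle_div_r; [|lra]. destruct (Rle_dec (truncated_mass d) 0); nra.
Qed.

Definition truncated_mass_limit (I : R) : Prop := forall eta, 0 < eta ->
  exists d0, 0 < d0 /\ forall d, 0 < d <= d0 -> I - eta < truncated_mass d <= I.

Lemma ex_truncated_mass_limit : exists I, truncated_mass_limit I.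
Proof.
  destruct truncated_mass_bounded as [M HM].
  destruct (completeness (fun u => exists d, 0 < d /\ u = truncated_mass d)) as [I [Hub Hlub]].
  { exists M; intros u (d & Hd & ->); apply HM; auto. }
  { exists (truncated_mass 1), 1; split; [lra | auto]. }
  exists I; intros eta Heta.
  destruct (classic (exists d0, 0 < d0 /\ I - eta < truncated_mass d0)) as [(d0 & Hd0 & Hlt)|Hno].
  - exists d0; split; auto. intros d Hd.
    pose proof (truncated_mass_antitone d d0 ltac:(lra) ltac:(lra)).
    split; [lra | apply Hub; exists d; split; auto; lra].
  - exfalso. assert (I <= I - eta); [|lra]. apply Hlub. intros u (d & Hd & ->).
    apply Rnot_lt_le; intros Hlt; apply Hno; exists d; auto.
Qed.

Variable I : R.
Hypothesis HI : truncated_mass_limit I.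

Lemma improper_integral_of_truncated_mass : improper_integral v b I.
Proof.
  intros eta Heta. destruct (HI eta Heta) as (d0 & Hd0 & Hmass). exists d0; split; [lra|].
  intros eps Heps.
  destruct (RInt_cutoff_split 0 1 (fun y => ereal (v y)) b eps) as (Ileft & Iright & Esum);
    [lra | apply Hb | apply ex_RInt_truncation; lra|].
  exists (ex_RInt_Reals_0 _ _ _ Ileft), (ex_RInt_Reals_0 _ _ _ Iright).
  rewrite <- !RInt_Reals, Esum. fold (truncation eps) (truncated_mass eps).
  specialize (Hmass eps ltac:(lra)). rewrite Rabs_left1; lra.
Qed.

Lemma transfer_iter_truncation_cvg eta : 0 < eta -> exists d0, 0 < d0 /\ forall d, 0 < d <= d0 ->
  eventually (fun n => forall x, in01 x ->
    Rabs (transfer_iter n (truncation d) x - I * h r x) < eta).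
Proof.
  intros Heta. destruct h_bounds as (c & C & Hc & Hh).
  destruct (HI (eta / (2 * C))) as (d0 & Hd0 & Hmass); [apply Rdiv_lt_0_compat; lra|].
  exists d0; split; auto. intros d Hd. specialize (Hmass d Hd).
  destruct (transfer_iter_cvg _ (bounded_variation_truncation d (proj1 Hd)) (eta / 2))
    as [N HN]; [lra|].
  exists N; intros n Hn x Hx. specialize (HN n Hn x Hx). fold (truncated_mass d) in HN.
  specialize (Hh x Hx).
  assert ((I - truncated_mass d) * h r x <= eta / (2 * C) * C) by (apply Rmult_le_compat; lra).
  replace (eta / (2 * C) * C) with (eta / 2) in * by (field; lra).
  assert (0 <= (I - truncated_mass d) * h r x) by (apply Rmult_le_pos; lra).
  apply Rabs_def2 in HN. apply Rabs_def1; lra.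
Qed.

Lemma PFn_eventually_gt eps : 0 < eps ->
  eventually (fun n => forall x, in01 x -> egt (PFn r n v x) (I * h r x - eps)).
Proof.
  intros Heps. destruct (transfer_iter_truncation_cvg eps Heps) as (d & Hd & Hcvg).
  destruct (Hcvg d ltac:(lra)) as [N HN]. exists N; intros n Hn x Hx.
  specialize (HN n Hn x Hx). apply Rabs_def2 in HN.
  pose proof (PFn_ge n v _ x Hx (truncation_ege d)).
  destruct (PFn r n v x); simpl in *; auto; lra.
Qed.

Lemma ex_cvg_off_pole : exists a q, 0 < a < 1 /\ 0 < q < 1 /\ cvg_off_pole b v I a q.
Proof.
  set (a := (1 + alpha) / 2). assert (Ha : alpha < a < 1) by (unfold a; lra).
  destruct (transfer_iter_density_le a Ha) as (q & d0 & C & Hq & Hd0 & HC & Hle).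
  exists a, q. split; [lra|]. split; auto. intros B eps Heps.
  destruct (transfer_iter_truncation_cvg (eps / 2)) as (d1 & Hd1 & Hcvg); [lra|].
  set (Q := C * (1 + Rabs B)).
  assert (HQ : 0 < Q) by (pose proof (Rabs_pos B); unfold Q; apply Rmult_lt_0_compat; lra).
  destruct (Rpower_eventually_le (a - alpha) (eps / (2 * Q))) as (d2 & Hd2 & Hsmall);
    [lra | apply Rdiv_lt_0_compat; lra|].
  set (d := Rmin d0 (Rmin d1 d2)).
  assert (Hd : 0 < d /\ d <= d0 /\ d <= d1 /\ d <= d2).
  { unfold d, Rmin; repeat destruct (Rle_dec _ _); lra. }
  specialize (Hsmall d ltac:(lra)). destruct (Hcvg d ltac:(lra)) as [N HN].
  exists N; intros n Hn x Hx Hne HB. specialize (HN n Hn x Hx).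
  specialize (Hle d n x ltac:(lra) Hx Hne).
  rewrite (PFn_finite n v x Hx)
    by (intros z Hz Ez; apply density_finite; [auto | intros ->; auto]).
  assert (transfer_iter n (truncation d) x <= transfer_iter n (fun y => ereal (v y)) x).
  { apply transfer_iter_le; auto. intros z Hz _. apply truncation_bounds; auto. }
  assert (C * Rpower d (a - alpha) * (1 + q ^ n * pole a (orbit b n) x) <= eps / 2).
  { apply Rle_trans with (C * Rpower d (a - alpha) * (1 + Rabs B)).
    - apply Rmult_le_compat_l; [apply Rmult_le_pos; [lra | left; apply exp_pos]|].
      pose proof (Rle_abs B). lra.
    - replace (C * Rpower d (a - alpha) * (1 + Rabs B)) with (Rpower d (a - alpha) * Q)
        by (unfold Q; ring).
      replace (eps / 2) with (eps / (2 * Q) * Q) by (field; lra).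
      apply Rmult_le_compat_r; lra. }
  simpl. apply Rabs_def2 in HN. apply Rabs_def1; lra.
Qed.

End PoleDensity.

Section ConvergenceOffPole.

Variables (b : R) (v : R -> ER) (I a q : R).
Hypothesis Hb : in01 b.
Hypothesis Hpole : v b = PInf.
Hypothesis Ha : 0 < a < 1.
Hypothesis Hq : 0 < q < 1.
Hypothesis Hcvg : cvg_off_pole b v I a q.

Lemma PFn_cvg_uniform_compact (K : R -> Prop) : compact K ->
  (forall x, K x -> in01 x /\ ~ omega_limit r b x) -> forall eps, 0 < eps ->
  eventually (fun n => forall x, K x -> eclose (PFn r n v x) (I * h r x) eps).
Proof.
  intros HK HKomega eps Heps.
  destruct (compact_eventually_away (orbit b) K HK) as (c & Hc & Haway).
  { intros x Kx Hadh. apply (proj2 (HKomega x Kx)), omega_limit_ValAdh; auto. }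
  generalize (filter_and _ _ Haway (Hcvg (Rpower c (- a)) eps Heps)).
  apply filter_imp; intros n [Hfar Hn] x Kx. specialize (Hfar x Kx).
  apply Hn; [apply HKomega; auto | | apply pow_mult_pole_le; auto].
  apply ne_of_Rabs_minus_ge with c; auto.
Qed.

Lemma PFn_cvg_off_dim_0 : exists E : R -> Prop, (forall x, E x -> in01 x) /\ hausdorff_dim E 0 /\
  forall x, in01 x -> ~ E x -> forall eps, 0 < eps ->
  eventually (fun n => eclose (PFn r n v x) (I * h r x) eps).
Proof.
  set (rho := Rpower q (/ a)).
  assert (Hrho : 0 < rho < 1).
  { split; [apply exp_pos | apply Rpower_lt_1; [auto | apply Rinv_0_lt_compat; lra]]. }
  exists (fun x => in01 x /\
    forall N : nat, exists n, (N <= n)%nat /\ Rabs (x - orbit b n) < rho ^ n).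
  split; [tauto|]. split.
  - apply hausdorff_dim_0; intros s Hs.
    apply hausdorff_null_limsup_balls with (orbit b) rho; auto. tauto.
  - intros x Hx HE eps Heps.
    assert (Hfar : eventually (fun n => rho ^ n <= Rabs (x - orbit b n))).
    { destruct (eventually_or_frequently_not (fun n => rho ^ n <= Rabs (x - orbit b n)))
        as [|Hnear]; [auto|].
      destruct HE. split; auto. intros N. destruct (Hnear N) as (n & Hn & Hlt).
      exists n; split; [auto | lra]. }
    generalize (filter_and _ _ Hfar (Hcvg 1 eps Heps)).
    apply filter_imp; intros n [Hle Hn]. pose proof (pow_lt rho n (proj1 Hrho)).
    apply Hn; auto; [apply ne_of_Rabs_minus_ge with (rho ^ n); auto|].
    pose proof (pow_lt q n (proj1 Hq)).
    apply Rle_trans with (q ^ n * / q ^ n); [|right; field; lra].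
    apply Rmult_le_compat_l; [lra|].
    replace (/ q ^ n) with (Rpower (rho ^ n) (- a)); [apply Rpower_opp_le; lra|].
    rewrite Rpower_pow_swap by lra. unfold rho. rewrite Rpower_mult.
    replace (/ a * - a) with (-(1)) by (field; lra).
    rewrite Rpower_Ropp, Rpower_1, pow_inv by lra. reflexivity.
Qed.

Lemma PFn_frequently_infinite m x : preperiodic_m r b m -> omega_limit r b x ->
  forall N, exists n, (N <= n)%nat /\ PFn r n v x = PInf.
Proof.
  intros Hm Hx N. destruct (omega_limit_preperiodic b m x Hm Hx N) as (n & Hn & <-).
  exists n; split; auto. apply PFn_orbit_infinite; auto.
Qed.

Lemma PFn_eventually_infinite x : preperiodic_m r b 1 -> omega_limit r b x ->
  eventually (fun n => PFn r n v x = PInf).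
Proof.
  intros Hm Hx. destruct (orbit_periodic b 1 Hm) as [n0 Hper].
  destruct (omega_limit_preperiodic b 1 x Hm Hx n0) as (n1 & Hn1 & <-).
  exists n1; intros n Hn. rewrite <- (Hper n1 (n - n1)%nat Hn1).
  replace (n1 + (n - n1) * 1)%nat with n by lia. apply PFn_orbit_infinite; auto.
Qed.

Lemma PFn_frequently_close p x : period_length r b p -> (1 < p)%nat -> omega_limit r b x ->
  forall eps N, 0 < eps -> exists n, (N <= n)%nat /\ eclose (PFn r n v x) (I * h r x) eps.
Proof.
  intros Hp Hp1 Hx eps N Heps. destruct (orbit_periodic b p (proj1 Hp)) as [n0 Hper].
  destruct (orbit_frequently_ne b p x n0 Hp Hp1) as (n1 & Hn1 & Hne).
  destruct (Hcvg (Rpower (Rabs (x - orbit b n1)) (- a)) eps Heps) as [N' HN'].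
  assert (N + N' <= (N + N') * p)%nat by nia.
  exists (n1 + (N + N') * p)%nat. split; [lia|]. apply HN'; [lia | | |].
  - apply (omega_limit_preperiodic_in01 b p); auto; apply Hp.
  - rewrite Hper; auto.
  - rewrite Hper by auto. apply pow_mult_pole_le; auto. split; [apply Rabs_pos_lt; lra | lra].
Qed.

End ConvergenceOffPole.

End TransferOperator.

Lemma eclose_elt x y eps : eclose x y eps -> elt x (y + eps).
Proof. destruct x; simpl; auto. intros Hclose; apply Rabs_def2 in Hclose; lra. Qed.

Theorem theorem3p1 (r alpha beta : R) (v : R -> ER)
  (Hr : 0 <= r < 1) (Halpha : 0 < alpha < 1) (Hbeta : 0 <= beta <= 1)
  (Hv : in_U beta alpha v) :
  exists I : R, improper_integral v beta I /\
  (* uniform convergence on compact subsets of [0,1] \ Omega_r(beta) *)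
  (forall K : R -> Prop, compact K ->
     (forall x, K x -> 0 <= x <= 1 /\ ~ omega_limit r beta x) ->
     forall eps, eps > 0 -> exists N : nat, forall n : nat, (N <= n)%nat ->
       forall x, K x -> eclose (PFn r n v x) (I * h r x) eps) /\
  (* pointwise convergence off a set of Hausdorff dimension 0 *)
  (exists E : R -> Prop, (forall x, E x -> 0 <= x <= 1) /\ hausdorff_dim E 0 /\
     forall x, 0 <= x <= 1 -> ~ E x ->
       forall eps, eps > 0 -> exists N : nat, forall n : nat, (N <= n)%nat ->
         eclose (PFn r n v x) (I * h r x) eps) /\
  (* pre-periodic, period length > 1: liminf = I h_r(x), limsup = +oo on Omega *)
  (forall p : nat, period_length r beta p -> (p > 1)%nat ->
     forall x, omega_limit r beta x ->
       (forall eps, eps > 0 ->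
          (exists N : nat, forall n : nat, (N <= n)%nat -> egt (PFn r n v x) (I * h r x - eps)) /\
          (forall N : nat, exists n : nat, (N <= n)%nat /\ elt (PFn r n v x) (I * h r x + eps))) /\
       (forall M : R, forall N : nat, exists n : nat, (N <= n)%nat /\ ege (PFn r n v x) M)) /\
  (* pre-periodic, period length 1: limit +oo on Omega *)
  (period_length r beta 1 ->
     forall x, omega_limit r beta x ->
       forall M : R, exists N : nat, forall n : nat, (N <= n)%nat -> ege (PFn r n v x) M).
Proof.
  destruct (ex_truncated_mass_limit r Hr alpha beta v Halpha Hbeta Hv) as [I HI].
  destruct (ex_cvg_off_pole r Hr alpha beta v Halpha Hbeta Hv I HI) as (a & q & Ha & Hq & Hcvg).
  assert (Hpole : v beta = PInf) by (destruct Hv as (_ & _ & _ & d & C1 & C2 & Hd); apply Hd).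
  exists I. split; [|split; [|split; [|split]]].
  - apply improper_integral_of_truncated_mass with alpha; auto.
  - apply (PFn_cvg_uniform_compact r beta v I a q); auto.
  - apply (PFn_cvg_off_dim_0 r Hr beta v I a q); auto.
  - intros p Hp Hp1 x Hx. split; [intros eps Heps; split|].
    + assert (Hx01 : in01 x) by (eapply omega_limit_preperiodic_in01; eauto; apply Hp).
      destruct (PFn_eventually_gt r Hr alpha beta v Hv I HI eps Heps) as [N HN].
      exists N; intros n Hn; apply HN; auto.
    + intros N. destruct (PFn_frequently_close r Hr beta v I a q Hbeta Ha Hq Hcvg p x) with eps N
        as (n & Hn & Hclose); eauto using eclose_elt.
    + intros M N. destruct (PFn_frequently_infinite r Hr beta v Hbeta Hpole p x) with N
        as (n & Hn & E); [apply Hp | auto | exists n; rewrite E; simpl; auto].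
  - intros [Hp _] x Hx M.
    destruct (PFn_eventually_infinite r Hr beta v Hbeta Hpole x Hp Hx) as [N HN].
    exists N; intros n Hn; rewrite HN; simpl; auto.
Qed.
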